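(* Let $m\ge 0$ be an integer. There is a unique pair $(u,W)$ of real functions solving, for $r>0$, $$u''+\frac{1}{r}u'-\frac{m^2}{r^2}u=(W-1)u,\qquad W''+\frac{1}{r}W'=|u|^2,$$ with $u$ continuous on $[0,\infty)$, $W$ extending to a $C^1$ function on $[0,\infty)$ with $W(0)=W'(0)=0$, and such that $u(r)>0$ for all $r>0$ and $u(r)\to 0$ as $r\to\infty$.
   Context: These are the radial equations $\Delta(u e^{im\theta})=(W-1)u e^{im\theta}$, $\Delta W=|u|^2$ on $\mathbb{R}^2$ in polar coordinates $(r,\theta)$. *)

(* Defs.v *)
From Stdlib Require Import Reals.
From Coquelicot Require Import Coquelicot.
Open Scope R_scope.

(* (u, W) is a solution, in the sense of the paper, of the radial system
     u'' + u'/r - m^2 u / r^2 = (W - 1) u,   W'' + W'/r = |u|^2   (r > 0)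
   with the boundary / regularity conditions.  The functions are defined on
   all of R, but only their values on [0, oo) are meaningful; the value of W
   at 0 plays the role of the C^1 extension of W to [0, oo). *)
Definition is_radial_solution (m : nat) (u W : R -> R) : Prop :=
  (forall r, 0 < r ->
     ex_derive u r /\ ex_derive (Derive u) r /\
     ex_derive W r /\ ex_derive (Derive W) r) /\
  (forall r, 0 < r ->
     Derive (Derive u) r + / r * Derive u r - (INR m) ^ 2 / r ^ 2 * u r
       = (W r - 1) * u r) /\
  (forall r, 0 < r ->
     Derive (Derive W) r + / r * Derive W r = (Rabs (u r)) ^ 2) /\
  (* u continuous on [0, oo): right-continuity at 0 (continuity on (0,oo)
     follows from differentiability) *)
  filterlim u (at_right 0) (locally (u 0)) /\
  (* W extends to a C^1 function on [0, oo) with W(0) = W'(0) = 0: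
     the extension takes the value W 0 = 0 at 0, has right derivative 0
     at 0, and its derivative is right-continuous at 0 *)
  W 0 = 0 /\
  filterlim (fun h => (W h - W 0) / h) (at_right 0) (locally 0) /\
  filterlim (Derive W) (at_right 0) (locally 0) /\
  (forall r, 0 < r -> 0 < u r) /\
  is_lim u p_infty 0.

(* Main.v *)
Require Import Defs.
From Stdlib Require Import Reals Lra Lia Classical.
From Coquelicot Require Import Coquelicot.
Open Scope R_scope.

(** Put [v = u / r^m]; then [v'' + (2m+1)/r v' = (W - 1) v] and
    [W'' + W'/r = r^(2m) v^2], with [W] nondecreasing.

    Existence is by shooting in the eigenvalue: replace [1] by [E] and normalise
    [v 0 = 1], which is undone at the end by the scaling
    [u(r) -> l^2 u(l r)], [W(r) -> l^2 W(l r)] with [l^2 E = 1].  The wanted solution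
    satisfies [0 <= v <= 1], so [v] may be truncated to [0, 1] in the nonlinear
    terms, and the Picard iteration converges globally.  The sets of [E] for which [v]
    becomes negative, resp. increases somewhere, are open and disjoint; the first
    contains large [E] and the second contains [0], so some [E > 0] lies in neither.
    For it [v] is nonincreasing and nonnegative, and the flux [r^(2m+1) v'] is
    eventually increasing and bounded by [0], which yields [v = O(r^(-2m-2))].

    For uniqueness, every solution has a limit [v(0+) = a].  If [a1 < a2], the
    Wronskian identity
    [(r^(2m+1) (v1' v2 - v1 v2'))' = r^(2m+1) v1 v2 (W1 - W2)] shows that [v1/v2]
    decreases, so that [W1 < W2] throughout; as [u2] tends to [0], the derivative of
    [v1/v2] is at most [-c/r] near infinity, which contradicts positivity.  If
    [a1 = a2], Gronwall's inequality applies to the sum of squares of the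
    differences of [v, v', W, W'], since the singular terms have a good sign. *)

(** * Monotonicity and zeros of real functions *)

(** The coefficients are singular at 0, so initial value theory does not apply there directly;
    [g'' + (k / r) g' = f] with regular data is instead inverted by two integrations, the inner one
    producing the flux [r ^ k * g']. Varying [E] at fixed [v 0 = 1] is equivalent, by scaling, to
    varying the initial value at eigenvalue 1, and has the merit that one truncation level serves
    all parameters. The lower truncation also explains why the two bad sets are disjoint: where
    [v <= 0] the force vanishes and the flux is frozen at a negative value for ever, whereas a
    positive flux requires [W > E] and persists because [W] is monotone. For uniqueness the obstacle
    is the weak assumption at the origin, where [u] is only known to be continuous: the second mode,
    of order [r ^ (- m)] for [u] or logarithmic if [m = 0], must be excluded, and [v' -> 0] proved,
    before any comparison can start from 0. What makes this possible is that [W < 1] near 0, so that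
    positivity of [v] makes the flux [r ^ (2 * m + 1) * v'] monotone there. *)

Lemma is_derive_Rplus (f g : R -> R) (x df dg : R) :
  is_derive f x df -> is_derive g x dg -> is_derive (fun t => f t + g t) x (df + dg).
Proof. exact (is_derive_plus f g x df dg). Qed.

Lemma is_derive_Rminus (f g : R -> R) (x df dg : R) :
  is_derive f x df -> is_derive g x dg -> is_derive (fun t => f t - g t) x (df - dg).
Proof. exact (is_derive_minus f g x df dg). Qed.

Lemma is_derive_Rmult (f g : R -> R) (x df dg : R) :
  is_derive f x df -> is_derive g x dg ->
  is_derive (fun t => f t * g t) x (df * g x + f x * dg).
Proof. intros Hf Hg. exact (is_derive_mult f g x df dg Hf Hg Rmult_comm). Qed.

Lemma mean_value (f df : R -> R) (a b : R) : a < b ->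
  (forall x, a <= x <= b -> is_derive f x (df x)) ->
  exists c, a < c < b /\ f b - f a = df c * (b - a).
Proof.
  intros Hab Hd.
  destruct (MVT_cor2 f df a b Hab) as [c [H1 H2]].
  - intros c Hc. apply is_derive_Reals, Hd, Hc.
  - exists c; split; [exact H2 | exact H1].
Qed.

Lemma derive_nonneg_le (f df : R -> R) (a b : R) : a <= b ->
  (forall x, a <= x <= b -> is_derive f x (df x)) ->
  (forall x, a < x < b -> 0 <= df x) -> f a <= f b.
Proof.
  intros [Hab | ->] Hd Hp; [|lra].
  destruct (mean_value f df a b Hab Hd) as [c [Hc E]].
  pose proof (Hp c Hc). nra.
Qed.

Lemma derive_nonpos_ge (f df : R -> R) (a b : R) : a <= b ->
  (forall x, a <= x <= b -> is_derive f x (df x)) ->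
  (forall x, a < x < b -> df x <= 0) -> f b <= f a.
Proof.
  intros [Hab | ->] Hd Hp; [|lra].
  destruct (mean_value f df a b Hab Hd) as [c [Hc E]].
  pose proof (Hp c Hc). nra.
Qed.

Lemma derive_pos_lt (f df : R -> R) (a b : R) : a < b ->
  (forall x, a <= x <= b -> is_derive f x (df x)) ->
  (forall x, a < x < b -> 0 < df x) -> f a < f b.
Proof.
  intros Hab Hd Hp.
  destruct (mean_value f df a b Hab Hd) as [c [Hc E]].
  pose proof (Hp c Hc). nra.
Qed.

Lemma derive_neg_gt (f df : R -> R) (a b : R) : a < b ->
  (forall x, a <= x <= b -> is_derive f x (df x)) ->
  (forall x, a < x < b -> df x < 0) -> f b < f a.
Proof.
  intros Hab Hd Hp.
  destruct (mean_value f df a b Hab Hd) as [c [Hc E]].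
  pose proof (Hp c Hc). nra.
Qed.

Lemma derive_zero_eq (f df : R -> R) (a b : R) : a <= b ->
  (forall x, a <= x <= b -> is_derive f x (df x)) ->
  (forall x, a < x < b -> df x = 0) -> f b = f a.
Proof.
  intros Hab Hd Hp. apply Rle_antisym.
  - apply (derive_nonpos_ge f df); auto. intros x Hx. rewrite Hp; auto; lra.
  - apply (derive_nonneg_le f df); auto. intros x Hx. rewrite Hp; auto; lra.
Qed.

(** Since [ln] is unbounded at both ends, a bounded function cannot sustain a rate [c / x]; this
    excludes fluxes of the wrong sign at 0 and makes [W] unbounded at infinity. *)
Lemma log_growth (f df : R -> R) (a b c : R) : 0 < a -> a <= b ->
  (forall x, a <= x <= b -> is_derive f x (df x)) ->
  (forall x, a < x < b -> c / x <= df x) -> c * (ln b - ln a) <= f b - f a.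
Proof.
  intros Ha Hab Hd Hp.
  cut (f a - c * ln a <= f b - c * ln b); [lra|].
  apply (derive_nonneg_le (fun x => f x - c * ln x) (fun x => df x - c * / x)); auto.
  - intros x Hx. apply is_derive_Rminus; [apply Hd, Hx|].
    apply is_derive_scal. apply is_derive_Reals, derivable_pt_lim_ln; lra.
  - intros x Hx. specialize (Hp x Hx). unfold Rdiv in Hp. lra.
Qed.

Lemma ln_unbounded_right (a M : R) : 0 < a -> exists b, a < b /\ M < ln b - ln a.
Proof.
  intros Ha. exists (a * exp (Rabs M + 1)).
  pose proof (Rabs_pos M). pose proof (Rle_abs M).
  pose proof (exp_ineq1 (Rabs M + 1)).
  split; [nra|].
  rewrite ln_mult; auto using exp_pos. rewrite ln_exp. lra.
Qed.

Lemma ln_unbounded_left (a M : R) : 0 < a -> exists b, 0 < b < a /\ M < ln a - ln b.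
Proof.
  intros Ha. exists (a * exp (- (Rabs M + 1))).
  pose proof (Rabs_pos M). pose proof (Rle_abs M).
  assert (exp (- (Rabs M + 1)) < exp 0) by (apply exp_increasing; lra).
  rewrite exp_0 in *. pose proof (exp_pos (- (Rabs M + 1))).
  split; [split; nra|].
  rewrite ln_mult; auto using exp_pos. rewrite ln_exp. lra.
Qed.

(** Beyond the intermediate value theorem, the supremum of the points where [f >= 0] also gives the
    sign of [f] all the way to [b]. *)
Lemma last_zero (f : R -> R) (a b : R) : a <= b ->
  (forall x, a <= x <= b -> continuous f x) -> 0 <= f a -> f b < 0 ->
  exists z, a <= z < b /\ f z = 0 /\ forall t, z < t <= b -> f t < 0.
Proof.
  intros Hab Hc Ha Hb.
  set (S := fun z => a <= z <= b /\ 0 <= f z).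
  destruct (completeness S) as [z [Hub Hlub]].
  - exists b. intros x [Hx _]; lra.
  - exists a. split; [lra | exact Ha].
  - assert (Haz : a <= z) by (apply Hub; split; [lra | exact Ha]).
    assert (Hzb : z <= b) by (apply Hlub; intros x [Hx _]; lra).
    assert (Hz : forall t, z < t <= b -> f t < 0).
    { intros t Ht. destruct (Rlt_le_dec (f t) 0) as [H|H]; auto.
      assert (t <= z) by (apply Hub; split; [lra|exact H]). lra. }
    assert (Hlt : ~ f z < 0).
    { intro Hn. assert (Ho : locally z (fun y => f y < 0)).
      { apply (Hc z (conj Haz Hzb) (fun y => y < 0)). apply open_lt, Hn. }
      destruct Ho as [d Hd].
      assert (Hu : is_upper_bound S (z - d / 2)).
      { intros x [Hx Hfx]. assert (x <= z) by (apply Hub; split; auto).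
        apply Rnot_lt_le; intro Hxd.
        assert (f x < 0); [|lra].
        apply Hd. change (Rabs (x - z) < d). destruct d as [d Hdp]; simpl in *.
        apply Rabs_def1; lra. }
      specialize (Hlub _ Hu). destruct d as [d Hdp]; simpl in *; lra. }
    assert (Hgt : ~ 0 < f z).
    { intro Hn. assert (Hz1 : z < b) by (destruct Hzb as [H| ->]; [exact H | lra]).
      assert (Ho : locally z (fun y => 0 < f y)).
      { apply (Hc z (conj Haz Hzb) (fun y => 0 < y)). apply open_gt, Hn. }
      destruct Ho as [d Hd]. destruct d as [d Hdp]; simpl in *.
      set (t := Rmin b (z + d / 2)).
      assert (z < t <= b) by (unfold t; split; [apply Rmin_glb_lt; lra | apply Rmin_l]).
      assert (t <= z + d / 2) by apply Rmin_r.
      specialize (Hz t H).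
      assert (0 < f t); [|lra]. apply Hd.
      change (Rabs (t - z) < d). apply Rabs_def1; lra. }
    exists z. split; [|split]; [|lra|exact Hz].
    split; auto. destruct Hzb as [H| ->]; [exact H | lra].
Qed.

Lemma first_zero (f : R -> R) (a b : R) : a <= b ->
  (forall x, a <= x <= b -> continuous f x) -> f a < 0 -> 0 <= f b ->
  exists z, a < z <= b /\ f z = 0 /\ forall t, a <= t < z -> f t < 0.
Proof.
  intros Hab Hc Ha Hb.
  destruct (last_zero (fun x => f (- x)) (- b) (- a)) as [z [Hz [Hfz Hneg]]]; try lra.
  - intros x Hx. apply (continuous_comp Ropp f); [|apply Hc; lra].
    apply (continuous_opp (fun x : R => x)), continuous_id.
  - now rewrite Ropp_involutive.
  - now rewrite Ropp_involutive.
  - exists (- z). split; [lra|split; [exact Hfz|]].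
    intros t Ht. specialize (Hneg (- t)). rewrite Ropp_involutive in Hneg.
    apply Hneg; lra.
Qed.

(** * The inverse radial operator *)

Definition wint (k : nat) (f : R -> R) (s : R) : R :=
  RInt (fun t => t ^ k * f t) 0 s.

(** The derivative of the solution of [g'' + (k / r) g' = f] that is regular at 0. The value 0 for
    [s <= 0] makes it continuous on all of R, so that integrals and derivatives at 0 can be
    two-sided. *)
Definition slope (k : nat) (f : R -> R) (s : R) : R :=
  if Rle_dec s 0 then 0 else wint k f s / s ^ k.

(* [J k f] inverts the radial operator [g'' + (k/r) g'] with [g 0 = g' 0 = 0]
   on [0, oo), and is extended by [0] to the negative axis. *)
Definition J (k : nat) (f : R -> R) (r : R) : R := RInt (slope k f) 0 r.

Definition cont (f : R -> R) : Prop := forall x, continuous f x.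

Lemma continuous_Rpow (k : nat) : cont (fun t => t ^ k).
Proof.
  intro x. apply (ex_derive_continuous (fun t : R => t ^ k)). auto_derive; auto.
Qed.

Lemma continuous_weight (k : nat) (f : R -> R) : cont f -> cont (fun t => t ^ k * f t).
Proof.
  intros Hf x. apply (continuous_mult (fun t => t ^ k) f); [apply continuous_Rpow | apply Hf].
Qed.

Lemma ex_RInt_cont (f : R -> R) (a b : R) : cont f -> ex_RInt f a b.
Proof. intros Hf. apply (ex_RInt_continuous (V := R_CompleteNormedModule)). intros; apply Hf. Qed.

Lemma is_derive_RInt_cont (f : R -> R) (x : R) : cont f -> is_derive (fun s => RInt f 0 s) x (f x).
Proof.
  intros Hf. apply (is_derive_RInt f (fun s => RInt f 0 s) 0 x).
  - apply filter_forall. intro y. apply (RInt_correct (V := R_CompleteNormedModule)), ex_RInt_cont, Hf.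
  - apply Hf.
Qed.

Lemma is_derive_wint (k : nat) (f : R -> R) (s : R) : cont f ->
  is_derive (wint k f) s (s ^ k * f s).
Proof.
  intros Hf. apply (is_derive_RInt_cont (fun t => t ^ k * f t)), continuous_weight, Hf.
Qed.

Lemma wint_0 (k : nat) (f : R -> R) : wint k f 0 = 0.
Proof. exact (RInt_point 0 (fun t => t ^ k * f t)). Qed.

(** Bounding [t ^ k] by [s ^ k] under the integral makes the weight cancel against the division in
    [slope], so the resulting constants do not depend on [k] and do not blow up at 0. *)
Lemma wint_bound (k : nat) (f : R -> R) (c l s : R) : cont f -> 0 <= c -> 0 < l -> 0 <= s ->
  (forall t, 0 <= t <= s -> Rabs (f t) <= c * exp (l * t)) ->
  Rabs (wint k f s) <= s ^ k * (c * (exp (l * s) - 1) / l).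
Proof.
  intros Hf Hc Hl Hs Hb.
  assert (Hw : forall t, 0 <= t <= s -> is_derive (fun t => s ^ k * (c * (exp (l * t) - 1) / l)) t
      (s ^ k * (c * exp (l * t)))).
  { intros t Ht. auto_derive; auto. field. lra. }
  assert (Hk : forall t, 0 <= t <= s -> Rabs (t ^ k * f t) <= s ^ k * (c * exp (l * t))).
  { intros t Ht. rewrite Rabs_mult. apply Rmult_le_compat; try apply Rabs_pos; auto.
    rewrite Rabs_pos_eq by (apply pow_le; lra). apply pow_incr; lra. }
  apply Rabs_le. split.
  - cut (wint k f 0 + s ^ k * (c * (exp (l * 0) - 1) / l) <= wint k f s + s ^ k * (c * (exp (l * s) - 1) / l)).
    { rewrite wint_0, Rmult_0_r, exp_0. unfold Rminus, Rdiv. rewrite Rplus_opp_r. lra. }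
    apply (derive_nonneg_le (fun t => wint k f t + s ^ k * (c * (exp (l * t) - 1) / l))
             (fun t => t ^ k * f t + s ^ k * (c * exp (l * t)))); auto.
    + intros t Ht. apply is_derive_Rplus; [now apply is_derive_wint | now apply Hw].
    + intros t Ht. specialize (Hk t ltac:(lra)). apply Rabs_le_between in Hk. lra.
  - cut (s ^ k * (c * (exp (l * 0) - 1) / l) - wint k f 0 <= s ^ k * (c * (exp (l * s) - 1) / l) - wint k f s).
    { rewrite wint_0, Rmult_0_r, exp_0. unfold Rminus, Rdiv. rewrite Rplus_opp_r. lra. }
    apply (derive_nonneg_le (fun t => s ^ k * (c * (exp (l * t) - 1) / l) - wint k f t)
             (fun t => s ^ k * (c * exp (l * t)) - t ^ k * f t)); auto.
    + intros t Ht. apply is_derive_Rminus; [now apply Hw | now apply is_derive_wint].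
    + intros t Ht. specialize (Hk t ltac:(lra)). apply Rabs_le_between in Hk. lra.
Qed.

Lemma slope_pos (k : nat) (f : R -> R) (s : R) : 0 < s -> slope k f s = wint k f s / s ^ k.
Proof. intros Hs. unfold slope. destruct (Rle_dec s 0); [lra|auto]. Qed.

Lemma slope_nonpos (k : nat) (f : R -> R) (s : R) : s <= 0 -> slope k f s = 0.
Proof. intros Hs. unfold slope. destruct (Rle_dec s 0); [auto|lra]. Qed.

Lemma slope_bound (k : nat) (f : R -> R) (c l s : R) : cont f -> 0 <= c -> 0 < l -> 0 <= s ->
  (forall t, 0 <= t <= s -> Rabs (f t) <= c * exp (l * t)) ->
  Rabs (slope k f s) <= c * (exp (l * s) - 1) / l.
Proof.
  intros Hf Hc Hl [Hs | <-] Hb.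
  - rewrite slope_pos by auto.
    pose proof (wint_bound k f c l s Hf Hc Hl ltac:(lra) Hb) as H.
    assert (0 < s ^ k) by (apply pow_lt, Hs).
    unfold Rdiv at 1. rewrite Rabs_mult, Rabs_inv, (Rabs_pos_eq (s ^ k)) by lra.
    apply (Rmult_le_reg_r (s ^ k)); auto.
    rewrite Rmult_assoc, Rinv_l by lra. rewrite Rmult_1_r, (Rmult_comm _ (s ^ k)). exact H.
  - rewrite slope_nonpos by lra. rewrite Rabs_R0, Rmult_0_r, exp_0. unfold Rdiv. lra.
Qed.

Lemma is_derive_slope (k : nat) (f : R -> R) (r : R) : cont f -> 0 < r ->
  is_derive (slope k f) r (f r - INR k / r * slope k f r).
Proof.
  intros Hf Hr.
  apply (is_derive_ext_loc (fun s => wint k f s / s ^ k)).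
  - exists (mkposreal r Hr). intros y Hy. change (Rabs (y - r) < r) in Hy.
    apply Rabs_def2 in Hy. symmetry. apply slope_pos; lra.
  - rewrite slope_pos by auto.
    pose proof (is_derive_wint k f r Hf) as Hw.
    assert (Hk : 0 < r ^ k) by (apply pow_lt, Hr).
    assert (Hp : is_derive (fun s : R => s ^ k) r (INR k * r ^ pred k)).
    { auto_derive; auto. ring. }
    evar_last; [apply is_derive_div; [exact Hw | exact Hp | lra] |].
    destruct k as [|k]; simpl pred; simpl pow in *; [simpl; field; lra |].
    assert (0 < r ^ k) by (apply pow_lt, Hr).
    field. split; lra.
Qed.

Lemma cont_bounded (f : R -> R) (b : R) : cont f -> 0 <= b ->
  exists C, 0 <= C /\ forall t, 0 <= t <= b -> Rabs (f t) <= C.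
Proof.
  intros Hf Hb.
  destruct (continuity_ab_maj (fun t => Rabs (f t)) 0 b Hb) as [M [HM _]].
  - intros c _. apply continuity_pt_filterlim.
    apply (continuous_comp f Rabs); [apply Hf | apply continuous_Rabs].
  - exists (Rabs (f M)). split; [apply Rabs_pos | exact HM].
Qed.

Lemma continuous_slope (k : nat) (f : R -> R) : cont f -> cont (slope k f).
Proof.
  intros Hf x. destruct (Rlt_le_dec 0 x) as [Hx|Hx].
  - apply (ex_derive_continuous (slope k f)). eexists. now apply is_derive_slope.
  - destruct (cont_bounded f 1 Hf ltac:(lra)) as [C [HC HfC]].
    apply filterlim_locally. intro eps. rewrite (slope_nonpos k f x Hx).
    (* With [l = 1] the bound on the slope vanishes at the origin, which gives continuity where the
       definition switches to 0. *)
    assert (Hln : forall s, 0 <= s <= 1 -> Rabs (slope k f s) <= C * (exp s - 1)).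
    { intros s Hs. replace (C * (exp s - 1)) with (C * (exp (1 * s) - 1) / 1) by (rewrite Rmult_1_l; field).
      apply slope_bound; auto; try lra. intros t Ht.
      eapply Rle_trans; [apply HfC; lra|]. rewrite Rmult_1_l.
      pose proof (exp_ineq1_le t). nra. }
    assert (Hexp : continuous (fun s => C * (exp s - 1)) 0).
    { apply (ex_derive_continuous (fun s => C * (exp s - 1))). auto_derive; auto. }
    pose proof (proj1 (filterlim_locally _ _) Hexp eps) as [d Hd].
    destruct (Rlt_le_dec x 0) as [Hx0|Hx0].
    + exists (mkposreal (- x) ltac:(lra)). intros y Hy. change (Rabs (y - x) < - x) in Hy.
      apply Rabs_def2 in Hy. rewrite slope_nonpos by lra. apply ball_center.
    + assert (x = 0) by lra. subst x.
      exists (mkposreal (Rmin d 1) ltac:(apply Rmin_glb_lt; [apply cond_pos|lra])).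
      intros y Hy. change (Rabs (y - 0) < Rmin d 1) in Hy.
      rewrite Rminus_0_r in Hy. change (Rabs (slope k f y - 0) < eps). rewrite Rminus_0_r.
      destruct (Rle_lt_dec y 0) as [Hy0|Hy0].
      * rewrite slope_nonpos by auto. rewrite Rabs_R0. apply cond_pos.
      * pose proof (Rmin_l d 1). pose proof (Rmin_r d 1). pose proof (Rle_abs y).
        eapply Rle_lt_trans; [apply Hln; lra|].
        specialize (Hd y). change (Rabs (y - 0) < d -> Rabs (C * (exp y - 1) - C * (exp 0 - 1)) < eps) in Hd.
        rewrite Rminus_0_r, exp_0 in Hd. specialize (Hd ltac:(lra)).
        eapply Rle_lt_trans; [apply Rle_abs|].
        replace (C * (exp y - 1)) with (C * (exp y - 1) - C * (1 - 1)) by ring. exact Hd.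
Qed.

Lemma is_derive_J (k : nat) (f : R -> R) (r : R) : cont f -> is_derive (J k f) r (slope k f r).
Proof. intros Hf. apply is_derive_RInt_cont, continuous_slope, Hf. Qed.

Lemma continuous_J (k : nat) (f : R -> R) : cont f -> cont (J k f).
Proof.
  intros Hf x. apply (ex_derive_continuous (J k f)). eexists. now apply is_derive_J.
Qed.

Lemma J_0 (k : nat) (f : R -> R) : J k f 0 = 0.
Proof. exact (RInt_point 0 (slope k f)). Qed.

Lemma J_nonpos (k : nat) (f : R -> R) (r : R) : r <= 0 -> J k f r = 0.
Proof.
  intros Hr. unfold J. rewrite (RInt_ext (slope k f) (fun _ => 0)).
  - rewrite RInt_const. apply Rmult_0_r.
  - intros x [_ Hx]. rewrite Rmax_left in Hx by lra. apply slope_nonpos; lra.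
Qed.

Lemma wint_minus (k : nat) (f g : R -> R) (s : R) : cont f -> cont g ->
  wint k (fun t => f t - g t) s = wint k f s - wint k g s.
Proof.
  intros Hf Hg. unfold wint.
  rewrite <- (RInt_minus (fun t => t ^ k * f t) (fun t => t ^ k * g t));
    try (apply ex_RInt_cont, continuous_weight; assumption).
  apply RInt_ext. intros x _. unfold minus, plus, opp; simpl. ring.
Qed.

Lemma J_minus (k : nat) (f g : R -> R) (r : R) : cont f -> cont g ->
  J k (fun t => f t - g t) r = J k f r - J k g r.
Proof.
  intros Hf Hg. unfold J.
  rewrite <- (RInt_minus (slope k f) (slope k g));
    try (apply ex_RInt_cont, continuous_slope; assumption).
  apply RInt_ext. intros x _. unfold minus, plus, opp; simpl. unfold slope.
  destruct (Rle_dec x 0); [ring|]. rewrite wint_minus by auto. unfold Rdiv. ring.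
Qed.

(** Each of the two integrations against [exp (l * t)] gains a factor [1 / l]. A large [l] therefore
    makes the inverse operator small in the weighted norm, however long the interval is. *)
Lemma J_bound (k : nat) (f : R -> R) (c l r : R) : cont f -> 0 <= c -> 0 < l -> 0 <= r ->
  (forall t, 0 <= t <= r -> Rabs (f t) <= c * exp (l * t)) ->
  Rabs (J k f r) <= c / l ^ 2 * exp (l * r).
Proof.
  intros Hf Hc Hl Hr Hb.
  assert (Hs : forall s, 0 <= s <= r -> Rabs (slope k f s) <= c * exp (l * s) / l).
  { intros s Hs. eapply Rle_trans; [apply (slope_bound k f c l s); auto; try lra|].
    - intros t Ht. apply Hb; lra.
    - apply Rmult_le_compat_r; [left; now apply Rinv_0_lt_compat | nra]. }
  assert (Hw : forall t, 0 <= t <= r -> is_derive (fun t => c / l ^ 2 * exp (l * t)) t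
      (c * exp (l * t) / l)).
  { intros t Ht. auto_derive; auto. field. lra. }
  assert (Hp : 0 <= c / l ^ 2).
  { apply Rmult_le_pos; auto. left. apply Rinv_0_lt_compat. nra. }
  apply Rabs_le. split.
  - cut (J k f 0 + c / l ^ 2 * exp (l * 0) <= J k f r + c / l ^ 2 * exp (l * r)).
    { rewrite J_0, Rmult_0_r, exp_0. lra. }
    apply (derive_nonneg_le (fun t => J k f t + c / l ^ 2 * exp (l * t))
             (fun t => slope k f t + c * exp (l * t) / l)); auto.
    + intros t Ht. apply is_derive_Rplus; [now apply is_derive_J | now apply Hw].
    + intros t Ht. specialize (Hs t ltac:(lra)). apply Rabs_le_between in Hs. lra.
  - cut (c / l ^ 2 * exp (l * 0) - J k f 0 <= c / l ^ 2 * exp (l * r) - J k f r).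
    { rewrite J_0, Rmult_0_r, exp_0. lra. }
    apply (derive_nonneg_le (fun t => c / l ^ 2 * exp (l * t) - J k f t)
             (fun t => c * exp (l * t) / l - slope k f t)); auto.
    + intros t Ht. apply is_derive_Rminus; [now apply Hw | now apply is_derive_J].
    + intros t Ht. specialize (Hs t ltac:(lra)). apply Rabs_le_between in Hs. lra.
Qed.

(** * The truncated system *)

Definition clamp (x : R) : R := Rmax 0 (Rmin 1 x).

Lemma clamp_bounds (x : R) : 0 <= clamp x <= 1.
Proof.
  unfold clamp. split; [apply Rmax_l|]. apply Rmax_lub; [lra | apply Rmin_l].
Qed.

Lemma clamp_lipschitz (x y : R) : Rabs (clamp x - clamp y) <= Rabs (x - y).
Proof.
  unfold clamp, Rmin. destruct (Rle_dec 1 x), (Rle_dec 1 y); unfold Rmax;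
  repeat match goal with |- context [Rle_dec ?a ?b] => destruct (Rle_dec a b) end;
  apply Rabs_le; unfold Rabs; destruct (Rcase_abs (x - y)); lra.
Qed.

Lemma clamp_id (x : R) : 0 <= x <= 1 -> clamp x = x.
Proof. intros Hx. unfold clamp. rewrite Rmin_right by lra. apply Rmax_right; lra. Qed.

Lemma clamp_nonpos (x : R) : x <= 0 -> clamp x = 0.
Proof. intros Hx. unfold clamp. rewrite Rmin_right by lra. apply Rmax_left; lra. Qed.

Lemma continuous_clamp (v : R -> R) : cont v -> cont (fun t => clamp (v t)).
Proof.
  intros Hv x. apply (continuous_comp v clamp); [apply Hv|].
  apply filterlim_locally. intro eps. exists eps. intros y Hy.
  change (Rabs (clamp y - clamp (v x)) < eps).
  eapply Rle_lt_trans; [apply clamp_lipschitz | exact Hy].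
Qed.

Definition density (m : nat) (v : R -> R) (t : R) : R := t ^ (2 * m) * clamp (v t) ^ 2.

Definition potential (m : nat) (v : R -> R) : R -> R := J 1 (density m v).

Definition force (m : nat) (E : R) (v : R -> R) (t : R) : R :=
  (potential m v t - E) * clamp (v t).

Definition step (m : nat) (E : R) (v : R -> R) (r : R) : R :=
  1 + J (2 * m + 1) (force m E v) r.

(* The system for [v = u / r^m] with [v 0 = 1] and the eigenvalue [1] replaced by
   a parameter [E], truncated so as to be globally Lipschitz. *)
Definition profile (m : nat) (E : R) (v : R -> R) : Prop :=
  cont v /\ forall r, v r = step m E v r.

Lemma continuous_density (m : nat) (v : R -> R) : cont v -> cont (density m v).
Proof.
  intros Hv. apply continuous_weight. intro x.
  apply (continuous_comp (fun t => clamp (v t)) (fun y => y ^ 2)).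
  - apply continuous_clamp, Hv.
  - apply continuous_Rpow.
Qed.

Lemma continuous_potential (m : nat) (v : R -> R) : cont v -> cont (potential m v).
Proof. intros Hv. apply continuous_J, continuous_density, Hv. Qed.

Lemma continuous_force (m : nat) (E : R) (v : R -> R) : cont v -> cont (force m E v).
Proof.
  intros Hv x. apply (continuous_mult (fun t => potential m v t - E) (fun t => clamp (v t))).
  - apply (continuous_minus (potential m v) (fun _ => E)).
    + now apply continuous_potential.
    + apply continuous_const.
  - now apply continuous_clamp.
Qed.

Lemma continuous_step (m : nat) (E : R) (v : R -> R) : cont v -> cont (step m E v).
Proof.
  intros Hv x. apply (continuous_plus (fun _ => 1) (J (2 * m + 1) (force m E v))).
  - apply continuous_const.
  - now apply continuous_J, continuous_force.
Qed.

Lemma density_bound (m : nat) (v : R -> R) (R0 t : R) : 0 <= t <= R0 ->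
  0 <= density m v t <= R0 ^ (2 * m).
Proof.
  intros Ht. unfold density. pose proof (clamp_bounds (v t)).
  assert (0 <= t ^ (2 * m) <= R0 ^ (2 * m)).
  { split; [apply pow_le; lra | apply pow_incr; lra]. }
  split; [apply Rmult_le_pos; nra|].
  rewrite <- (Rmult_1_r (R0 ^ _)). apply Rmult_le_compat; nra.
Qed.

Lemma potential_bound (m : nat) (v : R -> R) (R0 t : R) : cont v -> 0 <= t <= R0 ->
  Rabs (potential m v t) <= R0 ^ (2 * m) * exp R0.
Proof.
  intros Hv Ht.
  assert (Hp : 0 <= R0 ^ (2 * m)) by (apply pow_le; lra).
  eapply Rle_trans; [apply (J_bound 1 _ (R0 ^ (2 * m)) 1)|]; try lra.
  - now apply continuous_density.
  - intros s Hs. rewrite Rmult_1_l.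
    pose proof (density_bound m v R0 s ltac:(lra)).
    rewrite Rabs_pos_eq by lra. pose proof (exp_ineq1_le s). nra.
  - replace (R0 ^ (2 * m) / 1 ^ 2) with (R0 ^ (2 * m)) by field.
    apply Rmult_le_compat_l; auto. rewrite Rmult_1_l.
    destruct (proj2 Ht) as [H | ->]; [left; now apply exp_increasing | lra].
Qed.

(** One inequality serves two ends: with [E = E'] it is the contraction behind the Picard iteration,
    and with distinct parameters it yields Lipschitz dependence on the eigenvalue. *)
Lemma step_contraction (m : nat) (R0 E0 : R) : 0 <= R0 -> 0 <= E0 ->
  exists l, 0 < l /\ forall E E' v w c, 0 <= E' <= E0 -> cont v -> cont w -> 0 <= c ->
    (forall t, 0 <= t <= R0 -> Rabs (v t - w t) <= c * exp (l * t)) ->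
    forall t, 0 <= t <= R0 ->
      Rabs (step m E v t - step m E' w t) <= (c / 2 + Rabs (E - E')) * exp (l * t).
Proof.
  intros HR HE.
  set (A := R0 ^ (2 * m)).
  assert (HA : 0 <= A) by (apply pow_le; lra).
  (* [2 * A] is the Lipschitz constant of the density, since two clamped values add up to at most 2;
     the rest bounds the potential minus [E']. The choice of [l] below gives
     [K / l ^ 2 <= 1 / 2]. *)
  set (K := 2 * A + (A * exp R0 + E0)).
  assert (HB : 0 <= A * exp R0) by (apply Rmult_le_pos; [exact HA | left; apply exp_pos]).
  assert (HK : 0 <= K) by (unfold K; lra).
  set (l := 2 * K + 2).
  assert (Hl : 2 <= l) by (unfold l; lra).
  exists l. split; [lra|].
  intros E E' v w c HE' Hv Hw Hc Hvw t Ht.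
  pose proof (Rabs_pos (E - E')) as HD. set (D := Rabs (E - E')) in *.
  assert (Hinv : 0 <= / l ^ 2 <= 1).
  { split; [left; apply Rinv_0_lt_compat; nra|].
    rewrite <- Rinv_1. apply Rinv_le_contravar; nra. }
  assert (Hdens : forall s, 0 <= s <= R0 ->
    Rabs (density m v s - density m w s) <= 2 * A * c * exp (l * s)).
  { intros s Hs. unfold density.
    replace (s ^ (2 * m) * clamp (v s) ^ 2 - s ^ (2 * m) * clamp (w s) ^ 2)
      with (s ^ (2 * m) * (clamp (v s) + clamp (w s)) * (clamp (v s) - clamp (w s))) by ring.
    pose proof (clamp_bounds (v s)). pose proof (clamp_bounds (w s)).
    assert (0 <= s ^ (2 * m) <= A).
    { split; [apply pow_le; lra | apply pow_incr; lra]. }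
    rewrite Rabs_mult, (Rmult_assoc (2 * A)). apply Rmult_le_compat; try apply Rabs_pos.
    - rewrite Rabs_pos_eq; nra.
    - eapply Rle_trans; [apply clamp_lipschitz | now apply Hvw]. }
  assert (Hpot : forall s, 0 <= s <= R0 ->
    Rabs (potential m v s - potential m w s) <= 2 * A * c * exp (l * s)).
  { intros s Hs. unfold potential.
    rewrite <- J_minus by now apply continuous_density.
    assert (0 <= 2 * A * c) by (apply Rmult_le_pos; lra).
    eapply Rle_trans; [apply (J_bound 1 _ (2 * A * c) l); try lra|].
    - intro x. apply (continuous_minus (density m v) (density m w)); now apply continuous_density.
    - intros x Hx. apply Hdens; lra.
    - apply Rmult_le_compat_r; [left; apply exp_pos|]. unfold Rdiv. nra. }
  assert (Hforce : forall s, 0 <= s <= R0 ->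
    Rabs (force m E v s - force m E' w s) <= (K * c + D) * exp (l * s)).
  { intros s Hs. unfold force.
    (* The split pairs the potential of [w] with [E'], whose range is controlled by [E0], while
       [E - E'] meets a factor in [[0, 1]]. *)
    replace ((potential m v s - E) * clamp (v s) - (potential m w s - E') * clamp (w s))
      with ((potential m v s - potential m w s) * clamp (v s)
        + (potential m w s - E') * (clamp (v s) - clamp (w s)) - (E - E') * clamp (v s)) by ring.
    assert (He : 1 <= exp (l * s)).
    { pose proof (exp_ineq1_le (l * s)). assert (0 <= l * s) by (apply Rmult_le_pos; lra). lra. }
    pose proof (clamp_bounds (v s)).
    assert (H1 : Rabs ((potential m v s - potential m w s) * clamp (v s)) <= 2 * A * c * exp (l * s)).
    { rewrite Rabs_mult, (Rabs_pos_eq (clamp (v s))) by lra.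
      pose proof (Hpot s Hs). pose proof (Rabs_pos (potential m v s - potential m w s)). nra. }
    assert (H2 : Rabs ((potential m w s - E') * (clamp (v s) - clamp (w s)))
      <= (A * exp R0 + E0) * (c * exp (l * s))).
    { rewrite Rabs_mult. apply Rmult_le_compat; try apply Rabs_pos.
      - pose proof (potential_bound m w R0 s Hw Hs) as Hb. fold A in Hb.
        apply Rabs_le_between in Hb. apply Rabs_le. lra.
      - eapply Rle_trans; [apply clamp_lipschitz | now apply Hvw]. }
    assert (H3 : Rabs ((E - E') * clamp (v s)) <= D * exp (l * s)).
    { rewrite Rabs_mult, (Rabs_pos_eq (clamp (v s))) by lra. fold D. nra. }
    apply Rabs_le_between in H1. apply Rabs_le_between in H2. apply Rabs_le_between in H3.
    unfold K. apply Rabs_le. lra. }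
  unfold step.
  replace (1 + J (2 * m + 1) (force m E v) t - (1 + J (2 * m + 1) (force m E' w) t))
    with (J (2 * m + 1) (force m E v) t - J (2 * m + 1) (force m E' w) t) by ring.
  rewrite <- J_minus by now apply continuous_force.
  assert (HKc : 0 <= K * c) by (apply Rmult_le_pos; lra).
  eapply Rle_trans; [apply (J_bound _ _ (K * c + D) l); try lra|].
  - intro x. apply (continuous_minus (force m E v) (force m E' w)); now apply continuous_force.
  - intros s Hs. apply Hforce; lra.
  - apply Rmult_le_compat_r; [left; apply exp_pos|].
    assert (HKl : K * / l ^ 2 <= / 2).
    { apply (Rmult_le_reg_r (l ^ 2)); [nra|].
      rewrite Rmult_assoc, Rinv_l by nra. unfold l. nra. }
    unfold Rdiv. replace ((K * c + D) * / l ^ 2) with (K * / l ^ 2 * c + D * / l ^ 2) by ring. nra.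
Qed.

(** * Picard iteration and dependence on the eigenvalue *)

Lemma half_pow_pos (n : nat) : 0 < (/ 2) ^ n.
Proof. apply pow_lt; lra. Qed.

Lemma half_pow_small (C eps : R) : 0 < eps -> exists N, forall n, (N <= n)%nat -> C * (/ 2) ^ n < eps.
Proof.
  intros He.
  assert (Hl : is_lim_seq (fun n => C * (/ 2) ^ n) (C * 0)).
  { apply is_lim_seq_scal_l with (lu := Finite 0). apply is_lim_seq_geom.
    rewrite Rabs_pos_eq; lra. }
  rewrite Rmult_0_r in Hl. apply is_lim_seq_spec in Hl.
  destruct (Hl (mkposreal eps He)) as [N HN]. exists N. intros n Hn.
  specialize (HN n Hn). simpl in HN. rewrite Rminus_0_r in HN.
  eapply Rle_lt_trans; [apply Rle_abs | exact HN].
Qed.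

Fixpoint picard (m : nat) (E : R) (n : nat) : R -> R :=
  match n with
  | O => fun _ => 1
  | S n => step m E (picard m E n)
  end.

Lemma continuous_picard (m : nat) (E : R) (n : nat) : cont (picard m E n).
Proof.
  induction n as [|n IH]; simpl.
  - intro x. apply continuous_const.
  - now apply continuous_step.
Qed.

Lemma picard_nonpos (m : nat) (E : R) (n : nat) (t : R) : t <= 0 -> picard m E n t = 1.
Proof.
  intros Ht. destruct n as [|n]; simpl; [reflexivity|].
  unfold step. rewrite J_nonpos by exact Ht. lra.
Qed.

(** The weight depends on the interval [[0, R0]], but the iterates do not. The limit is therefore
    taken pointwise once and for all, and its continuity and the fixed point equation are checked on
    each interval with a suitable weight. *)
Lemma profile_exists (m : nat) (E : R) : 0 <= E -> exists v, profile m E v.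
Proof.
  intros HE.
  assert (Hcauchy : forall R0, 0 <= R0 -> exists l C, 0 < l /\ 0 <= C /\
    (forall v w c, cont v -> cont w -> 0 <= c ->
      (forall t, 0 <= t <= R0 -> Rabs (v t - w t) <= c * exp (l * t)) ->
      forall t, 0 <= t <= R0 -> Rabs (step m E v t - step m E w t) <= c / 2 * exp (l * t)) /\
    forall n p t, 0 <= t <= R0 ->
      Rabs (picard m E (n + p) t - picard m E n t) <= C * (/ 2) ^ n * exp (l * t)).
  { intros R0 HR.
    destruct (step_contraction m R0 E HR HE) as [l [Hl Hc]].
    destruct (cont_bounded (fun t => picard m E 1 t - picard m E 0 t) R0) as [C [HC Hb]]; auto.
    { intro x. apply (continuous_minus (picard m E 1) (picard m E 0)); apply continuous_picard. }
    assert (Hc' : forall v w c, cont v -> cont w -> 0 <= c ->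
      (forall t, 0 <= t <= R0 -> Rabs (v t - w t) <= c * exp (l * t)) ->
      forall t, 0 <= t <= R0 -> Rabs (step m E v t - step m E w t) <= c / 2 * exp (l * t)).
    { intros v w c Hv Hw Hc0 Hvw t Ht.
      pose proof (Hc E E v w c ltac:(lra) Hv Hw Hc0 Hvw t Ht) as H.
      rewrite Rminus_diag, Rabs_R0, Rplus_0_r in H. exact H. }
    exists l, (2 * C). split; [exact Hl|]. split; [lra|]. split; [exact Hc'|].
    assert (Hn : forall n t, 0 <= t <= R0 ->
      Rabs (picard m E (S n) t - picard m E n t) <= C * (/ 2) ^ n * exp (l * t)).
    { induction n as [|n IH]; intros t Ht.
      - rewrite pow_O, Rmult_1_r. eapply Rle_trans; [apply Hb, Ht|].
        pose proof (exp_ineq1_le (l * t)). assert (0 <= l * t) by (apply Rmult_le_pos; lra). nra.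
      - pose proof (half_pow_pos n).
        pose proof (Hc' (picard m E (S n)) (picard m E n) (C * (/ 2) ^ n)
          (continuous_picard m E _) (continuous_picard m E _) ltac:(nra) IH t Ht) as H1.
        replace (C * (/ 2) ^ S n) with (C * (/ 2) ^ n / 2) by (simpl; field). exact H1. }
    intros n p t Ht.
    (* The geometric sum is kept in closed form because the cruder bound by its limit would not
       survive the induction on [p]. *)
    cut (Rabs (picard m E (n + p) t - picard m E n t) <= 2 * C * ((/ 2) ^ n - (/ 2) ^ (n + p)) * exp (l * t)).
    { intros H. eapply Rle_trans; [exact H|]. pose proof (half_pow_pos (n + p)).
      pose proof (exp_pos (l * t)). apply Rmult_le_compat_r; nra. }
    induction p as [|p IH].
    - rewrite Nat.add_0_r, !Rminus_diag, Rabs_R0, Rmult_0_r. lra.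
    - rewrite Nat.add_succ_r.
      replace (picard m E (S (n + p)) t - picard m E n t)
        with ((picard m E (S (n + p)) t - picard m E (n + p) t) + (picard m E (n + p) t - picard m E n t)) by ring.
      eapply Rle_trans; [apply Rabs_triang|].
      pose proof (Hn (n + p)%nat t Ht).
      replace (2 * C * ((/ 2) ^ n - (/ 2) ^ S (n + p)) * exp (l * t))
        with (C * (/ 2) ^ (n + p) * exp (l * t) + 2 * C * ((/ 2) ^ n - (/ 2) ^ (n + p)) * exp (l * t))
        by (simpl; field).
      lra. }
  set (v := fun t => real (Lim_seq (fun n => picard m E n t))).
  assert (Hlim : forall t, is_lim_seq (fun n => picard m E n t) (v t)).
  { intros t. apply Lim_seq_correct'. destruct (Rle_lt_dec t 0) as [Ht|Ht].
    - exists 1. apply (is_lim_seq_ext (fun _ => 1)); [|apply is_lim_seq_const].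
      intro n. symmetry. now apply picard_nonpos.
    - apply ex_lim_seq_cauchy_corr. intro eps.
      destruct (Hcauchy t ltac:(lra)) as [l [C [Hl [HC [_ Hn]]]]].
      destruct (half_pow_small (C * exp (l * t)) (eps / 2)) as [N HN].
      { pose proof (cond_pos eps). lra. }
      specialize (HN N (le_n N)).
      exists N. intros n p Hn' Hp'.
      assert (H1 := Hn N (n - N)%nat t ltac:(lra)). assert (H2 := Hn N (p - N)%nat t ltac:(lra)).
      replace (N + (n - N))%nat with n in H1 by lia. replace (N + (p - N))%nat with p in H2 by lia.
      replace (C * (/ 2) ^ N * exp (l * t)) with (C * exp (l * t) * (/ 2) ^ N) in * by ring.
      apply Rabs_le_between in H1. apply Rabs_le_between in H2. apply Rabs_def1; lra. }
  assert (Hv1 : forall t, t <= 0 -> v t = 1).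
  { intros t Ht. pose proof (is_lim_seq_unique _ _ (Hlim t)) as H.
    rewrite (Lim_seq_ext _ (fun _ => 1)), Lim_seq_const in H; [now injection H|].
    intro n; now apply picard_nonpos. }
  assert (Hunif : forall R0, 0 <= R0 -> exists l C, 0 < l /\ 0 <= C /\
    (forall v w c, cont v -> cont w -> 0 <= c ->
      (forall t, 0 <= t <= R0 -> Rabs (v t - w t) <= c * exp (l * t)) ->
      forall t, 0 <= t <= R0 -> Rabs (step m E v t - step m E w t) <= c / 2 * exp (l * t)) /\
    forall n t, 0 <= t <= R0 -> Rabs (v t - picard m E n t) <= C * (/ 2) ^ n * exp (l * t)).
  { intros R0 HR. destruct (Hcauchy R0 HR) as [l [C [Hl [HC [Hs Hn]]]]].
    exists l, C. repeat split; auto. intros n t Ht.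
    assert (H1 : is_lim_seq (fun p => Rabs (picard m E (n + p) t - picard m E n t)) (Rabs (v t - picard m E n t))).
    { apply (is_lim_seq_abs _ (Finite (v t - picard m E n t))).
      apply is_lim_seq_minus'; [|apply is_lim_seq_const].
      apply (is_lim_seq_ext (fun p => picard m E (p + n) t)).
      - intro p. now rewrite Nat.add_comm.
      - apply (is_lim_seq_incr_n (fun p => picard m E p t)), Hlim. }
    apply (is_lim_seq_le _ _ (Rabs (v t - picard m E n t)) (C * (/ 2) ^ n * exp (l * t))
       (fun p => Hn n p t Ht) H1 (is_lim_seq_const _)). }
  assert (Hvc : cont v).
  { intro x. apply filterlim_locally. intro eps.
    pose proof (Rabs_pos x) as Hx0.
    destruct (Hunif (Rabs x + 1) ltac:(lra)) as [l [C [Hl [HC [_ Hn]]]]].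
    destruct (half_pow_small (C * exp (l * (Rabs x + 1))) (eps / 3)) as [N HN].
    { pose proof (cond_pos eps). lra. }
    specialize (HN N (le_n N)).
    assert (Hnear : forall t, t <= Rabs x + 1 -> Rabs (v t - picard m E N t) < eps / 3).
    { intros t Ht. destruct (Rle_lt_dec t 0) as [Ht0|Ht0].
      - rewrite Hv1, picard_nonpos, Rminus_diag, Rabs_R0 by auto. pose proof (cond_pos eps). lra.
      - eapply Rle_lt_trans; [apply Hn; lra|]. eapply Rle_lt_trans; [|exact HN].
        replace (C * exp (l * (Rabs x + 1)) * (/ 2) ^ N) with (C * (/ 2) ^ N * exp (l * (Rabs x + 1))) by ring.
        pose proof (half_pow_pos N).
        apply Rmult_le_compat_l; [nra|].
        destruct Ht as [Ht | ->]; [left; apply exp_increasing; nra | lra]. }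
    pose proof (proj1 (filterlim_locally _ _) (continuous_picard m E N x)
      (mkposreal (eps / 3) ltac:(pose proof (cond_pos eps); lra))) as [d Hd].
    exists (mkposreal (Rmin d 1) ltac:(apply Rmin_glb_lt; [apply cond_pos|lra])).
    intros y Hy. change (Rabs (y - x) < Rmin d 1) in Hy.
    pose proof (Rmin_l d 1). pose proof (Rmin_r d 1).
    specialize (Hd y ltac:(change (Rabs (y - x) < d); lra)).
    change (Rabs (picard m E N y - picard m E N x) < eps / 3) in Hd.
    change (Rabs (v y - v x) < eps).
    pose proof (Rle_abs x). apply Rabs_def2 in Hy.
    pose proof (Hnear x ltac:(lra)) as H2. pose proof (Hnear y ltac:(lra)) as H3.
    apply Rabs_def2 in Hd. apply Rabs_def2 in H2. apply Rabs_def2 in H3.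
    apply Rabs_def1; lra. }
  exists v. split; [exact Hvc|]. intro r.
  destruct (Rle_lt_dec r 0) as [Hr|Hr].
  { rewrite Hv1 by exact Hr. unfold step. rewrite J_nonpos by exact Hr. lra. }
  destruct (Hunif r ltac:(lra)) as [l [C [Hl [HC [Hs Hn]]]]].
  (* [v r] and [step m E v r] both lie within half the tolerance of the iterate [S N] at [r]: the
     first by convergence, the second by contraction from the iterate [N]. *)
  apply cond_eq. intros eps He.
  destruct (half_pow_small (C * exp (l * r)) eps He) as [N HN].
  specialize (HN N (le_n N)).
  pose proof (half_pow_pos N).
  assert (H1 := Hs v (picard m E N) (C * (/ 2) ^ N) Hvc (continuous_picard m E N) ltac:(nra) (Hn N) r ltac:(lra)).
  assert (H2 := Hn (S N) r ltac:(lra)).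
  replace (C * (/ 2) ^ N / 2 * exp (l * r)) with (C * exp (l * r) * (/ 2) ^ N / 2) in H1 by field.
  replace (C * (/ 2) ^ S N * exp (l * r)) with (C * exp (l * r) * (/ 2) ^ N / 2) in H2 by (simpl; field).
  change (picard m E (S N) r) with (step m E (picard m E N) r) in H2.
  apply Rabs_le_between in H1. apply Rabs_le_between in H2. apply Rabs_def1; lra.
Qed.

(** A contraction step turns a bound [c] into [c / 2 + D] with [D = Rabs (E - E')], whose fixed
    point is [2 * D]; iterating it improves any crude initial bound to that value. The case [E = E']
    is uniqueness of the profile on [[0, oo)]. *)
Lemma profile_lipschitz (m : nat) (R0 E0 : R) : 0 <= R0 -> 0 <= E0 ->
  exists K, 0 < K /\ forall E E' v w, 0 <= E' <= E0 -> profile m E v -> profile m E' w ->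
    forall t, 0 <= t <= R0 -> Rabs (v t - w t) <= K * Rabs (E - E').
Proof.
  intros HR HE. destruct (step_contraction m R0 E0 HR HE) as [l [Hl Hc]].
  exists (2 * exp (l * R0)). pose proof (exp_pos (l * R0)). split; [lra|].
  intros E E' v w HE' [Hv Hvs] [Hw Hws] t Ht.
  pose proof (Rabs_pos (E - E')) as HD. set (D := Rabs (E - E')) in *.
  destruct (cont_bounded (fun t => v t - w t) R0) as [C [HC Hb]]; auto.
  { intro x. now apply (continuous_minus v w). }
  assert (Hn : forall n t, 0 <= t <= R0 -> Rabs (v t - w t) <= (C * (/ 2) ^ n + 2 * D) * exp (l * t)).
  { induction n as [|n IH]; intros s Hs.
    - rewrite pow_O, Rmult_1_r. eapply Rle_trans; [apply Hb, Hs|].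
      pose proof (exp_ineq1_le (l * s)). assert (0 <= l * s) by (apply Rmult_le_pos; lra). nra.
    - rewrite (Hvs s), (Hws s). pose proof (half_pow_pos n).
      replace ((C * (/ 2) ^ S n + 2 * D) * exp (l * s))
        with (((C * (/ 2) ^ n + 2 * D) / 2 + D) * exp (l * s)) by (simpl; field).
      apply Hc; auto. nra. }
  assert (Hel : exp (l * t) <= exp (l * R0)).
  { destruct (proj2 Ht) as [H1 | ->]; [left; apply exp_increasing; nra | lra]. }
  apply le_epsilon. intros eps He.
  destruct (half_pow_small (C * exp (l * R0)) eps He) as [N HN].
  specialize (HN N (le_n N)). specialize (Hn N t Ht). pose proof (half_pow_pos N).
  assert (0 <= C * (/ 2) ^ N) by nra. nra.
Qed.

(** * Shooting *)

Lemma gronwall_forward (f df : R -> R) (a b C : R) : a <= b ->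
  (forall x, a <= x <= b -> is_derive f x (df x)) ->
  (forall x, a < x < b -> df x <= C * f x) -> f b <= f a * exp (C * (b - a)).
Proof.
  intros Hab Hd Hp.
  assert (H : f b * exp (- C * b) <= f a * exp (- C * a)).
  { apply (derive_nonpos_ge (fun x => f x * exp (- C * x))
      (fun x => df x * exp (- C * x) + f x * (- C * exp (- C * x)))); auto.
    - intros x Hx. apply (is_derive_Rmult f (fun x => exp (_ * x))); [now apply Hd|]. auto_derive; auto. ring.
    - intros x Hx. specialize (Hp x Hx). pose proof (exp_pos (- C * x)). nra. }
  apply (Rmult_le_compat_r (exp (C * b))) in H; [|left; apply exp_pos].
  rewrite !Rmult_assoc, <- !exp_plus in H.
  replace (- C * b + C * b) with 0 in H by ring. rewrite exp_0, Rmult_1_r in H.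
  now replace (- C * a + C * b) with (C * (b - a)) in H by ring.
Qed.

Lemma gronwall_backward (f df : R -> R) (a b C : R) : a <= b ->
  (forall x, a <= x <= b -> is_derive f x (df x)) ->
  (forall x, a < x < b -> - C * f x <= df x) -> f a <= f b * exp (C * (b - a)).
Proof.
  intros Hab Hd Hp.
  assert (H : f a * exp (C * a) <= f b * exp (C * b)).
  { apply (derive_nonneg_le (fun x => f x * exp (C * x))
      (fun x => df x * exp (C * x) + f x * (C * exp (C * x)))); auto.
    - intros x Hx. apply (is_derive_Rmult f (fun x => exp (_ * x))); [now apply Hd|]. auto_derive; auto. ring.
    - intros x Hx. specialize (Hp x Hx). pose proof (exp_pos (C * x)). nra. }
  apply (Rmult_le_compat_r (exp (- C * a))) in H; [|left; apply exp_pos].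
  rewrite !Rmult_assoc, <- !exp_plus in H.
  replace (C * a + - C * a) with 0 in H by ring. rewrite exp_0, Rmult_1_r in H.
  now replace (C * b + - C * a) with (C * (b - a)) in H by ring.
Qed.

(** Connectedness of [[0, b]]: the supremum of [B] lies in neither set, since openness of [A] would
    lower it and openness of [B] would raise it. *)
Lemma interval_not_two_open (A B : R -> Prop) (b : R) : 0 <= b ->
  (forall E, 0 <= E <= b -> A E -> exists d, 0 < d /\
     forall E', 0 <= E' <= b -> Rabs (E' - E) < d -> A E') ->
  (forall E, 0 <= E <= b -> B E -> exists d, 0 < d /\
     forall E', 0 <= E' <= b -> Rabs (E' - E) < d -> B E') ->
  (forall E, 0 <= E <= b -> A E -> B E -> False) ->
  B 0 -> A b -> exists E, 0 <= E <= b /\ ~ A E /\ ~ B E.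
Proof.
  intros Hb HA HB Hdisj HB0 HAb.
  set (S := fun E => 0 <= E <= b /\ B E).
  destruct (completeness S) as [e [Hub Hlub]].
  - exists b. intros x [Hx _]; lra.
  - exists 0. split; [lra | exact HB0].
  - assert (He0 : 0 <= e) by (apply Hub; split; [lra | exact HB0]).
    assert (Heb : e <= b) by (apply Hlub; intros x [Hx _]; lra).
    exists e. split; [lra|]. split; intro He.
    + destruct (HA e ltac:(lra) He) as [d [Hd Hn]].
      assert (Hu : is_upper_bound S (e - d / 2)).
      { intros x [Hx HBx]. assert (x <= e) by (apply Hub; split; auto).
        apply Rnot_lt_le; intro Hxd. apply (Hdisj x Hx); auto. apply Hn; auto.
        apply Rabs_def1; lra. }
      specialize (Hlub _ Hu). lra.
    + destruct (HB e ltac:(lra) He) as [d [Hd Hn]].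
      destruct Heb as [Heb | ->]; [|exact (Hdisj b ltac:(lra) HAb He)].
      set (x := Rmin b (e + d / 2)).
      assert (e < x <= b) by (unfold x; split; [apply Rmin_glb_lt; lra | apply Rmin_l]).
      assert (x <= e + d / 2) by apply Rmin_r.
      assert (x <= e); [|lra]. apply Hub. split; [lra|]. apply Hn; [lra|].
      apply Rabs_def1; lra.
Qed.

(** The right-hand side is the rate of [p ^ 2 + s ^ 2] along [p' = s], [s' = q p - k s]. A lower
    bound is what backward Gronwall needs: vanishing data at a point then vanish before it. *)
Lemma energy_rate_lower (p s q C k K : R) : - C <= q <= C -> 0 <= k <= K ->
  - (1 + C + 2 * K) * (p ^ 2 + s ^ 2) <= 2 * p * s + 2 * s * (q * p - k * s).
Proof.
  intros Hq Hk.
  assert (H1 : - (p ^ 2 + s ^ 2) <= 2 * p * s) by (pose proof (pow2_ge_0 (p + s)); nra).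
  assert (H2 : - C * (p ^ 2 + s ^ 2) <= 2 * s * (q * p)).
  { assert (0 <= (C + q) * (p + s) ^ 2) by (apply Rmult_le_pos; [lra | apply pow2_ge_0]).
    assert (0 <= (C - q) * (p - s) ^ 2) by (apply Rmult_le_pos; [lra | apply pow2_ge_0]). nra. }
  assert (H3 : k * s ^ 2 <= K * s ^ 2) by (apply Rmult_le_compat_r; [apply pow2_ge_0 | lra]).
  assert (H4 : 0 <= K * p ^ 2) by (apply Rmult_le_pos; [lra | apply pow2_ge_0]).
  nra.
Qed.

(** * Sign of the flux and monotonicity of a profile *)

Section Profile.

Variables (m : nat) (E : R) (v : R -> R).
Hypothesis Hprof : profile m E v.

Let k := (2 * m + 1)%nat.
Let dv := slope k (force m E v).
Let G := wint k (force m E v).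
Let W := potential m v.
Let dW := slope 1 (density m v).

Lemma profile_0 : v 0 = 1.
Proof. destruct Hprof as [_ H]. rewrite H. unfold step. rewrite J_0. lra. Qed.

Lemma profile_derive (r : R) : is_derive v r (dv r).
Proof.
  destruct Hprof as [Hv H].
  apply (is_derive_ext (step m E v)); [intro t; symmetry; apply H|].
  rewrite <- (Rplus_0_l (dv r)). apply is_derive_Rplus; [exact (is_derive_const (K := R_AbsRing) (V := R_NormedModule) 1 r)|].
  now apply is_derive_J, continuous_force.
Qed.

Lemma profile_flux_derive (r : R) : is_derive G r (r ^ k * force m E v r).
Proof. apply is_derive_wint, continuous_force, Hprof. Qed.

Lemma profile_flux_0 : G 0 = 0.
Proof. apply wint_0. Qed.

Lemma profile_slope_flux (r : R) : 0 < r -> G r = r ^ k * dv r.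
Proof.
  intros Hr. unfold dv. rewrite slope_pos by exact Hr. fold G.
  assert (0 < r ^ k) by (apply pow_lt, Hr). field. lra.
Qed.

Lemma profile_slope_pos (r : R) : 0 < r -> 0 < dv r <-> 0 < G r.
Proof.
  intros Hr. rewrite profile_slope_flux by exact Hr.
  assert (0 < r ^ k) by (apply pow_lt, Hr). split; intro; nra.
Qed.

Lemma profile_slope_neg (r : R) : 0 < r -> dv r < 0 <-> G r < 0.
Proof.
  intros Hr. rewrite profile_slope_flux by exact Hr.
  assert (0 < r ^ k) by (apply pow_lt, Hr). split; intro; nra.
Qed.

Lemma potential_derive (r : R) : is_derive W r (dW r).
Proof. apply is_derive_J, continuous_density, Hprof. Qed.

Lemma mass_mono (a b : R) : 0 <= a <= b -> wint 1 (density m v) a <= wint 1 (density m v) b.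
Proof.
  intros Hab. apply (derive_nonneg_le _ (fun s => s ^ 1 * density m v s)); [lra| |].
  - intros x Hx. apply is_derive_wint, continuous_density, Hprof.
  - intros x Hx. pose proof (density_bound m v x x ltac:(lra)). simpl. nra.
Qed.

Lemma potential_slope_nonneg (r : R) : 0 <= dW r.
Proof.
  unfold dW, slope. destruct (Rle_dec r 0) as [H|H]; [lra|].
  pose proof (mass_mono 0 r ltac:(lra)) as Hm. rewrite wint_0 in Hm.
  apply Rmult_le_pos; [exact Hm|]. left. apply Rinv_0_lt_compat, pow_lt. lra.
Qed.

Lemma potential_mono (a b : R) : a <= b -> W a <= W b.
Proof.
  intros Hab. apply (derive_nonneg_le W dW); auto.
  - intros; apply potential_derive.
  - intros; apply potential_slope_nonneg.
Qed.

Lemma potential_0 : W 0 = 0.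
Proof. apply J_0. Qed.

(* A positive flux forces [W > E] somewhere before, hence ever after, so that the
   flux cannot decrease again. *)
Lemma flux_pos_stable (c r : R) : 0 < c <= r -> 0 < G c -> 0 < G r.
Proof.
  intros Hc HG.
  destruct (mean_value G (fun s => s ^ k * force m E v s) 0 c) as [x [Hx Hmv]]; [lra| |].
  { intros; apply profile_flux_derive. }
  rewrite profile_flux_0 in Hmv.
  assert (Hxk : 0 < x ^ k) by (apply pow_lt; lra).
  assert (HW : E < W x).
  { apply Rnot_le_lt. intro Hle.
    assert (force m E v x <= 0).
    { unfold force. fold W. pose proof (clamp_bounds (v x)). nra. }
    assert (x ^ k * force m E v x <= 0) by nra. nra. }
  eapply Rlt_le_trans; [exact HG|].
  apply (derive_nonneg_le G (fun s => s ^ k * force m E v s)); [lra| |].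
  { intros; apply profile_flux_derive. }
  intros y Hy. pose proof (potential_mono x y ltac:(lra)). pose proof (clamp_bounds (v y)).
  apply Rmult_le_pos; [apply pow_le; lra|]. unfold force. fold W. nra.
Qed.

Lemma flux_const_of_nonpos (a b : R) : a <= b -> (forall t, a < t < b -> v t <= 0) -> G b = G a.
Proof.
  intros Hab Hn. apply (derive_zero_eq G (fun s => s ^ k * force m E v s)); auto.
  - intros; apply profile_flux_derive.
  - intros x Hx. unfold force. rewrite clamp_nonpos by now apply Hn. ring.
Qed.

(** After the last zero [z] before [a] the truncated force vanishes, so the flux keeps the value
    [G z], which is negative because [v] falls from [v z = 0] to [v a < 0]. Only a return of [v] to
    0 could end this, and the negative slope forbids it. *)
Lemma flux_neg_of_profile_neg (a r : R) : 0 <= a <= r -> v a < 0 -> G r < 0.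
Proof.
  intros Har Ha. destruct Hprof as [Hcont _]. pose proof profile_0 as H0.
  destruct (last_zero v 0 a) as [z [Hz [Hvz Hneg]]]; auto; try lra.
  assert (Hz0 : 0 < z).
  { destruct (proj1 Hz) as [H | <-]; [exact H | lra]. }
  assert (Hg : forall t, z <= t <= a -> G t = G z).
  { intros t Ht. apply flux_const_of_nonpos; [lra|]. intros s Hs. left. apply Hneg; lra. }
  assert (HGz : G z < 0).
  { destruct (mean_value v dv z a) as [c [Hc Hmv]]; [lra | intros; apply profile_derive |].
    rewrite <- (Hg c) by lra. apply profile_slope_neg; [lra|]. nra. }
  assert (Hall : forall t, a <= t -> v t < 0).
  { intros t Ht. apply Rnot_le_lt. intro Hvt.
    destruct (first_zero v a t) as [s [Hs [Hvs Hs']]]; auto; try lra.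
    destruct (mean_value v dv z s) as [c [Hc Hmv]]; [lra | intros; apply profile_derive |].
    assert (G c = G z).
    { apply flux_const_of_nonpos; [lra|]. intros x Hx. left.
      destruct (Rle_lt_dec x a); [apply Hneg | apply Hs']; lra. }
    assert (dv c < 0) by (apply profile_slope_neg; lra). nra. }
  replace (G r) with (G z); auto. symmetry.
  apply flux_const_of_nonpos; [lra|]. intros x Hx. left.
  destruct (Rle_lt_dec x a); [apply Hneg | apply Hall]; lra.
Qed.

Lemma flux_pos_of_increase (a b : R) : 0 <= a < b -> v a < v b -> exists c, 0 < c /\ 0 < G c.
Proof.
  intros Hab Hv. destruct (mean_value v dv a b) as [c [Hc Hmv]]; [lra | intros; apply profile_derive |].
  exists c. split; [lra|]. apply profile_slope_pos; [lra|]. nra.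
Qed.

Lemma increase_of_flux_pos (c : R) : 0 < c -> 0 < G c -> v c < v (c + 1).
Proof.
  intros Hc HG. apply (derive_pos_lt v dv); [lra | intros; apply profile_derive |].
  intros x Hx. apply profile_slope_pos; [lra|]. apply (flux_pos_stable c); auto. lra.
Qed.

(** Both behaviours persist, so the flux would have opposite signs at a common later point. *)
Lemma profile_not_both (a b c : R) : 0 <= a -> v a < 0 -> 0 <= b < c -> v b < v c -> False.
Proof.
  intros Ha Hva Hbc Hv. destruct (flux_pos_of_increase b c Hbc Hv) as [d [Hd HG]].
  pose proof (Rmax_l a d). pose proof (Rmax_r a d).
  assert (0 < G (Rmax a d)) by (apply (flux_pos_stable d); auto; lra).
  assert (G (Rmax a d) < 0) by (apply (flux_neg_of_profile_neg a); auto; lra). lra.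
Qed.

(** With [E = 0] the force is nonnegative, so [v] never falls below 1 and its clamped value is
    exactly 1. The density, then [W], then the force and the flux are thus strictly positive on
    [(0, oo)]. *)
Lemma profile_increases_low : E = 0 -> v 1 < v 2.
Proof.
  intros HE0.
  assert (Hf : forall t, 0 <= t -> 0 <= force m E v t).
  { intros t Ht. unfold force. fold W. pose proof (potential_mono 0 t Ht) as H.
    rewrite potential_0 in H. pose proof (clamp_bounds (v t)). nra. }
  assert (HG : forall t, 0 <= t -> 0 <= G t).
  { intros t Ht. rewrite <- profile_flux_0.
    apply (derive_nonneg_le G (fun s => s ^ k * force m E v s)); auto.
    - intros; apply profile_flux_derive.
    - intros x Hx. apply Rmult_le_pos; [apply pow_le; lra | apply Hf; lra]. }
  assert (Hd : forall t, 0 < t -> 0 <= dv t).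
  { intros t Ht. specialize (HG t ltac:(lra)). rewrite profile_slope_flux in HG by exact Ht.
    assert (0 < t ^ k) by (apply pow_lt, Ht). nra. }
  assert (Hv : forall t, 0 <= t -> 1 <= v t).
  { intros t Ht. rewrite <- profile_0. apply (derive_nonneg_le v dv); auto.
    - intros; apply profile_derive.
    - intros x Hx. apply Hd; lra. }
  assert (Hc : forall t, 0 <= t -> clamp (v t) = 1).
  { intros t Ht. unfold clamp. rewrite Rmin_left by (apply Hv, Ht). apply Rmax_right; lra. }
  assert (Hm : forall t, 0 < t -> 0 < wint 1 (density m v) t).
  { intros t Ht. rewrite <- (wint_0 1 (density m v)).
    apply (derive_pos_lt _ (fun s => s ^ 1 * density m v s)); auto.
    - intros x Hx. apply is_derive_wint, continuous_density, Hprof.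
    - intros x Hx. unfold density. rewrite Hc by lra.
      assert (0 < x ^ (2 * m)) by (apply pow_lt; lra). simpl pow at 1. nra. }
  assert (HW : forall t, 0 < t -> 0 < W t).
  { intros t Ht. rewrite <- potential_0. apply (derive_pos_lt W dW); auto.
    - intros; apply potential_derive.
    - intros x Hx. unfold dW. rewrite slope_pos by lra.
      apply Rmult_lt_0_compat; [apply Hm; lra | apply Rinv_0_lt_compat, pow_lt; lra]. }
  replace 2 with (1 + 1) by ring. apply increase_of_flux_pos; [lra|].
  rewrite <- profile_flux_0. apply (derive_pos_lt G (fun s => s ^ k * force m E v s)); [lra| |].
  - intros; apply profile_flux_derive.
  - intros x Hx. apply Rmult_lt_0_compat; [apply pow_lt; lra|].
    unfold force. fold W. rewrite Hc by lra. specialize (HW x ltac:(lra)). lra.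
Qed.

(** On [[0, 1]] the potential is at most [exp 1 <= 3], so the force is at most [- M * clamp (v t)].
    With [h = v (/ 2)] positive and [M * (/ 4) ^ k = 16], the flux drops by at least [4 * h] on
    [[1 / 4, 1 / 2]]; then [v' <= - 4 * h] on [[1 / 2, 1]], where [v] loses at least [2 * h]. *)
Lemma profile_neg_high : E = 3 + 4 * 4 ^ (k + 1) -> v 1 < 0.
Proof.
  intros HE. set (M := 4 * 4 ^ (k + 1)) in *.
  assert (HM : 0 < M) by (unfold M; pose proof (pow_lt 4 (k + 1)); lra).
  assert (HW : forall t, 0 <= t <= 1 -> W t - E <= - M).
  { intros t Ht. pose proof (potential_bound m v 1 t (proj1 Hprof) Ht) as H.
    rewrite pow1, Rmult_1_l in H. fold W in H. pose proof exp_le_3. pose proof (Rle_abs (W t)). lra. }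
  assert (Hf : forall t, 0 <= t <= 1 -> force m E v t <= - M * clamp (v t)).
  { intros t Ht. unfold force. fold W. specialize (HW t Ht). pose proof (clamp_bounds (v t)). nra. }
  assert (HGm : forall a b, 0 <= a <= b -> b <= 1 -> G b <= G a).
  { intros a b Hab Hb. apply (derive_nonpos_ge G (fun s => s ^ k * force m E v s)); [lra| |].
    - intros; apply profile_flux_derive.
    - intros x Hx. specialize (Hf x ltac:(lra)). pose proof (clamp_bounds (v x)).
      assert (0 <= x ^ k) by (apply pow_le; lra).
      assert (force m E v x <= 0) by nra. nra. }
  assert (HG0 : forall t, 0 <= t <= 1 -> G t <= 0).
  { intros t Ht. rewrite <- profile_flux_0. apply HGm; lra. }
  assert (Hd0 : forall t, 0 < t <= 1 -> dv t <= 0).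
  { intros t Ht. specialize (HG0 t ltac:(lra)). rewrite profile_slope_flux in HG0 by lra.
    assert (0 < t ^ k) by (apply pow_lt; lra). nra. }
  assert (Hvm : forall a b, 0 <= a <= b -> b <= 1 -> v b <= v a).
  { intros a b Hab Hb. apply (derive_nonpos_ge v dv); [lra| |].
    - intros; apply profile_derive.
    - intros x Hx. apply Hd0; lra. }
  pose proof profile_0 as H0.
  (* If [v] is already nonpositive at [1 / 2], some earlier flux is negative, and as the flux is
     nonincreasing on [[0, 1]], [v] decreases strictly up to 1. *)
  destruct (Rle_lt_dec (v (/ 2)) 0) as [Hh|Hh].
  - destruct (mean_value v dv 0 (/ 2)) as [c [Hc Hmv]]; [lra | intros; apply profile_derive |].
    assert (Hneg : G c < 0) by (apply profile_slope_neg; [lra|]; nra).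
    eapply Rlt_le_trans; [|exact Hh].
    apply (derive_neg_gt v dv); [lra | intros; apply profile_derive |].
    intros x Hx. apply profile_slope_neg; [lra|].
    eapply Rle_lt_trans; [|exact Hneg]. apply HGm; lra.
  - set (h := v (/ 2)) in *.
    assert (Hk : G (/ 2) <= - 4 * h).
    { destruct (mean_value G (fun s => s ^ k * force m E v s) (/ 4) (/ 2)) as [c [Hc Hmv]]; [lra| |].
      { intros; apply profile_flux_derive. }
      pose proof (HG0 (/ 4) ltac:(lra)).
      assert (Hvc : h <= v c <= 1).
      { split; [apply Hvm; lra|]. rewrite <- H0. apply Hvm; lra. }
      pose proof (Hf c ltac:(lra)) as Hfc. rewrite clamp_id in Hfc by lra.
      assert (Hck : (/ 4) ^ k <= c ^ k) by (apply pow_incr; lra).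
      assert (Hp : 0 < (/ 4) ^ k) by (apply pow_lt; lra).
      assert (HMk : M * (/ 4) ^ k = 16).
      { unfold M. rewrite pow_add, pow_inv. field. apply pow_nonzero; lra. }
      assert (c ^ k * force m E v c <= - 16 * h).
      { assert (force m E v c <= - M * h) by nra.
        assert (0 < M * h) by (apply Rmult_lt_0_compat; lra).
        apply (Rle_trans _ ((/ 4) ^ k * force m E v c)).
        - rewrite !(Rmult_comm _ (force m E v c)). apply Rmult_le_compat_neg_l; lra.
        - replace (- 16 * h) with (- (M * (/ 4) ^ k) * h) by (rewrite HMk; ring).
          replace (- (M * (/ 4) ^ k) * h) with ((/ 4) ^ k * (- M * h)) by ring.
          apply Rmult_le_compat_l; lra. }
      lra. }
    destruct (mean_value v dv (/ 2) 1) as [c [Hc Hmv]]; [lra | intros; apply profile_derive |].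
    fold h in Hmv.
    assert (HGc : G c <= - 4 * h) by (pose proof (HGm (/ 2) c ltac:(lra) ltac:(lra)); lra).
    rewrite profile_slope_flux in HGc by lra.
    assert (0 < c ^ k <= 1).
    { split; [apply pow_lt; lra|]. rewrite <- (pow1 k). apply pow_incr; lra. }
    assert (dv c <= - 4 * h).
    { assert (dv c <= c ^ k * dv c); [|lra]. pose proof (Hd0 c ltac:(lra)). nra. }
    nra.
Qed.

(** * The critical profile: positivity and decay *)

Hypothesis Hnonneg : forall r, 0 <= r -> 0 <= v r.
Hypothesis Hdecr : forall a b, 0 <= a <= b -> v b <= v a.

Lemma profile_clamp (r : R) : 0 <= r -> clamp (v r) = v r.
Proof.
  intros Hr. apply clamp_id. split; [now apply Hnonneg|].
  rewrite <- profile_0. apply Hdecr; lra.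
Qed.

(** A zero would force [v] to vanish identically afterwards, hence [v] and [v'] to vanish together
    at some [c]. Backward Gronwall on [[a, c]], with [a > 0] to avoid the singular coefficient, then
    contradicts [v a > 0] near the origin. *)
Lemma profile_pos (r : R) : 0 <= r -> 0 < v r.
Proof.
  intros Hr. apply Rnot_le_lt. intro Hle.
  assert (Hz : forall t, r <= t -> v t = 0).
  { intros t Ht. pose proof (Hnonneg t ltac:(lra)). pose proof (Hdecr r t ltac:(lra)). lra. }
  destruct (mean_value v dv r (r + 1)) as [c [Hc Hmv]]; [lra | intros; apply profile_derive |].
  rewrite !Hz in Hmv by lra.
  assert (Hdc : dv c = 0) by nra.
  assert (Hnear : exists a, 0 < a < c /\ 0 < v a).
  { pose proof profile_0 as H0.
    destruct (proj1 Hprof 0 (fun y => 0 < y)) as [d Hd].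
    { apply open_gt. lra. }
    exists (Rmin (d / 2) (c / 2)).
    pose proof (cond_pos d). pose proof (Rmin_l (d / 2) (c / 2)). pose proof (Rmin_r (d / 2) (c / 2)).
    assert (0 < Rmin (d / 2) (c / 2)) by (apply Rmin_glb_lt; lra).
    split; [lra|]. apply Hd. change (Rabs (Rmin (d / 2) (c / 2) - 0) < d).
    apply Rabs_def1; lra. }
  destruct Hnear as [a [Ha Hva]].
  set (C := c ^ (2 * m) * exp c + Rabs E).
  assert (HC : 0 <= C).
  { unfold C. pose proof (Rabs_pos E). pose proof (exp_pos c).
    assert (0 <= c ^ (2 * m)) by (apply pow_le; lra). nra. }
  assert (H : v a ^ 2 + dv a ^ 2 <= (v c ^ 2 + dv c ^ 2) * exp ((1 + C + 2 * (INR k / a)) * (c - a))).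
  { apply (gronwall_backward (fun x => v x ^ 2 + dv x ^ 2)
      (fun x => 2 * v x * dv x + 2 * dv x * (force m E v x - INR k / x * dv x))); [lra| |].
    - intros x Hx. pose proof (profile_derive x) as H1.
      assert (H2 := is_derive_slope k (force m E v) x (continuous_force m E v (proj1 Hprof)) ltac:(lra)).
      fold dv in H2. apply is_derive_Rplus.
      + replace (2 * v x * dv x) with (INR 2 * dv x * v x ^ pred 2) by (simpl; ring).
        now apply (is_derive_pow v 2 x).
      + replace (2 * dv x * (force m E v x - INR k / x * dv x))
          with (INR 2 * (force m E v x - INR k / x * dv x) * dv x ^ pred 2) by (simpl; ring).
        now apply (is_derive_pow dv 2 x).
    - intros x Hx. unfold force. fold W. rewrite profile_clamp by lra.
      assert (HWC : Rabs (W x - E) <= C).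
      { unfold C. eapply Rle_trans; [apply Rabs_triang|]. rewrite Rabs_Ropp.
        apply Rplus_le_compat_r. apply potential_bound; [apply Hprof | lra]. }
      assert (Hkx : 0 <= INR k / x <= INR k / a).
      { pose proof (pos_INR k). split.
        - apply Rmult_le_pos; [lra|]. left; apply Rinv_0_lt_compat; lra.
        - apply Rmult_le_compat_l; [lra|]. apply Rinv_le_contravar; lra. }
      apply Rabs_le_between in HWC.
      now apply energy_rate_lower. }
  rewrite Hdc, (Hz c) in H by lra.
  pose proof (pow2_ge_0 (dv a)). nra.
Qed.

(** [r W'] is the mass enclosed by radius [r]. For [r >= 1] it is at least the positive mass [h] of
    the unit disc, so [W] grows at least like [h * ln r]. *)
Lemma potential_unbounded (M : R) : exists r, 1 <= r /\ M <= W r.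
Proof.
  set (h := wint 1 (density m v) 1).
  assert (Hh : 0 < h).
  { unfold h. rewrite <- (wint_0 1 (density m v)).
    apply (derive_pos_lt _ (fun s => s ^ 1 * density m v s)); [lra| |].
    - intros x Hx. apply is_derive_wint, continuous_density, Hprof.
    - intros x Hx. unfold density. rewrite profile_clamp by lra.
      pose proof (profile_pos x ltac:(lra)).
      assert (0 < x ^ (2 * m)) by (apply pow_lt; lra).
      repeat apply Rmult_lt_0_compat; try lra. }
  destruct (ln_unbounded_right 1 (Rabs M / h) ltac:(lra)) as [b [Hb Hln]].
  exists b. split; [lra|].
  assert (Hg := log_growth W dW 1 b h ltac:(lra) ltac:(lra)).
  assert (h * (ln b - ln 1) <= W b - W 1).
  { apply Hg.
    - intros; apply potential_derive.
    - intros x Hx. unfold dW. rewrite slope_pos by lra. rewrite pow_1.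
      apply Rmult_le_compat_r; [left; apply Rinv_0_lt_compat; lra|]. apply mass_mono; lra. }
  pose proof (potential_mono 0 1 ltac:(lra)) as H1. rewrite potential_0 in H1.
  assert (Rabs M < h * (ln b - ln 1)).
  { apply (Rmult_lt_compat_l h) in Hln; auto. replace (h * (Rabs M / h)) with (Rabs M) in Hln by (field; lra). exact Hln. }
  pose proof (Rle_abs M). lra.
Qed.

Lemma flux_nonpos (r : R) : 0 < r -> G r <= 0.
Proof.
  intros Hr. apply Rnot_lt_le. intro HG.
  pose proof (increase_of_flux_pos r Hr HG). pose proof (Hdecr r (r + 1) ltac:(lra)). lra.
Qed.

(* Once [W >= E + 1] the nonpositive flux increases at rate at least [r^k v], which
   makes [r^(k+1) v] bounded. *)
Lemma profile_decay : is_lim (fun r => r ^ m * v r) p_infty 0.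
Proof.
  destruct (potential_unbounded (E + 1)) as [R1 [HR1 HW]].
  set (C := - G R1).
  assert (HWr : forall t, R1 <= t -> 1 <= W t - E).
  { intros t Ht. pose proof (potential_mono R1 t Ht). lra. }
  assert (HGm : forall t, R1 <= t -> - G t <= C).
  { intros t Ht. cut (G R1 <= G t); [unfold C; lra|].
    apply (derive_nonneg_le G (fun s => s ^ k * force m E v s)); auto.
    - intros; apply profile_flux_derive.
    - intros x Hx. apply Rmult_le_pos; [apply pow_le; lra|].
      unfold force. fold W. pose proof (HWr x ltac:(lra)). pose proof (clamp_bounds (v x)). nra. }
  (* On [[r / 2, r]] the weight is at least [(r / 2) ^ k] and the force at least [v r], while the
     flux can increase by at most [C]. Since [r / 2 >= 1], the power [k] may be lowered to the [m]
     of the claim, leaving a spare factor [1 / r]. *)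
  assert (Hb : forall r, 2 * R1 <= r -> r ^ m * v r <= 2 ^ (m + 1) * C / r).
  { intros r Hr.
    destruct (mean_value G (fun s => s ^ k * force m E v s) (r / 2) r) as [c [Hc Hmv]]; [lra| |].
    { intros; apply profile_flux_derive. }
    pose proof (HGm (r / 2) ltac:(lra)). pose proof (flux_nonpos r ltac:(lra)).
    pose proof (profile_pos r ltac:(lra)) as Hvr.
    assert (Hfc : v r <= force m E v c).
    { unfold force. fold W. rewrite profile_clamp by lra.
      pose proof (HWr c ltac:(lra)). pose proof (Hdecr c r ltac:(lra)). nra. }
    assert (Hck : (r / 2) ^ k <= c ^ k) by (apply pow_incr; lra).
    assert (Hp : 0 < (r / 2) ^ k) by (apply pow_lt; lra).
    assert (H1 : (r / 2) ^ k * v r * (r / 2) <= C).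
    { assert ((r / 2) ^ k * v r <= c ^ k * force m E v c) by (apply Rmult_le_compat; lra).
      nra. }
    assert (Hpm : (r / 2) ^ m <= (r / 2) ^ k).
    { apply Rle_pow; [lra | unfold k; lia]. }
    assert (H2 : (r / 2) ^ m * v r * (r / 2) <= C).
    { eapply Rle_trans; [|exact H1]. apply Rmult_le_compat_r; [lra|].
      apply Rmult_le_compat_r; lra. }
    apply (Rmult_le_reg_r r); [lra|].
    replace (2 ^ (m + 1) * C / r * r) with (2 ^ (m + 1) * C) by (field; lra).
    replace (r ^ m * v r * r) with (2 ^ (m + 1) * ((r / 2) ^ m * v r * (r / 2))).
    - apply Rmult_le_compat_l; [apply pow_le; lra | exact H2].
    - unfold Rdiv. rewrite Rpow_mult_distr, pow_add, pow_inv. field. apply pow_nonzero; lra. }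
  apply (is_lim_le_le_loc (fun _ => 0) (fun r => 2 ^ (m + 1) * C / r)).
  - exists (2 * R1). intros x Hx. split; [|apply Hb; lra].
    apply Rmult_le_pos; [apply pow_le; lra | apply Hnonneg; lra].
  - apply is_lim_const.
  - replace (Finite 0) with (Rbar_mult (2 ^ (m + 1) * C) (Rbar_inv p_infty)) by (simpl; f_equal; ring).
    apply (is_lim_scal_l Rinv). apply is_lim_inv; [apply is_lim_id | discriminate].
Qed.

End Profile.

Lemma shooting (m : nat) : exists E v, 0 < E /\ profile m E v /\
  (forall r, 0 <= r -> 0 <= v r) /\ (forall a b, 0 <= a <= b -> v b <= v a).
Proof.
  set (b := 3 + 4 * 4 ^ (2 * m + 1 + 1)).
  assert (Hb : 0 <= b) by (unfold b; pose proof (pow_lt 4 (2 * m + 1 + 1)); lra).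
  set (A := fun E => exists v, profile m E v /\ exists r, 0 <= r /\ v r < 0).
  set (B := fun E => exists v, profile m E v /\ exists r s, 0 <= r < s /\ v r < v s).
  destruct (interval_not_two_open A B b Hb) as [E [HE [HnA HnB]]].
  - intros E HE [v [Hv [r [Hr Hvr]]]].
    destruct (profile_lipschitz m r b Hr Hb) as [K [HK HL]].
    exists (- v r / K). split.
    { apply Rmult_lt_0_compat; [lra | now apply Rinv_0_lt_compat]. }
    intros E' HE' Hd. destruct (profile_exists m E' (proj1 HE')) as [w Hw].
    exists w. split; auto. exists r. split; auto.
    pose proof (HL E' E w v HE Hw Hv r ltac:(lra)) as H.
    apply (Rmult_lt_compat_l K) in Hd; auto.
    replace (K * (- v r / K)) with (- v r) in Hd by (field; lra).
    apply Rabs_le_between in H. lra.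
  - intros E HE [v [Hv [r [s [Hr Hvr]]]]].
    destruct (profile_lipschitz m s b ltac:(lra) Hb) as [K [HK HL]].
    exists ((v s - v r) / 2 / K). split.
    { apply Rmult_lt_0_compat; [lra | now apply Rinv_0_lt_compat]. }
    intros E' HE' Hd. destruct (profile_exists m E' (proj1 HE')) as [w Hw].
    exists w. split; auto. exists r, s. split; auto.
    pose proof (HL E' E w v HE Hw Hv r ltac:(lra)) as H1.
    pose proof (HL E' E w v HE Hw Hv s ltac:(lra)) as H2.
    apply (Rmult_lt_compat_l K) in Hd; auto.
    replace (K * ((v s - v r) / 2 / K)) with ((v s - v r) / 2) in Hd by (field; lra).
    apply Rabs_le_between in H1. apply Rabs_le_between in H2. lra.
  - intros E HE [v [Hv [r [Hr Hvr]]]] [w [Hw [s [t [Hst Hwst]]]]].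
    (* Membership in [A] and [B] is existential in the profile, so disjointness requires that two
       profiles with the same parameter agree. *)
    assert (Heq : forall x, 0 <= x -> v x = w x).
    { intros x Hx. destruct (profile_lipschitz m x b Hx Hb) as [K [HK HL]].
      pose proof (HL E E v w HE Hv Hw x ltac:(lra)) as H.
      rewrite Rminus_diag, Rabs_R0, Rmult_0_r in H.
      apply Rabs_le_between in H. lra. }
    rewrite <- !Heq in Hwst by lra.
    exact (profile_not_both m E v Hv r s t Hr Hvr Hst Hwst).
  - destruct (profile_exists m 0 (Rle_refl 0)) as [v Hv].
    exists v. split; auto. exists 1, 2. split; [lra|].
    now apply (profile_increases_low m 0).
  - destruct (profile_exists m b Hb) as [v Hv].
    exists v. split; auto. exists 1. split; [lra|].
    now apply (profile_neg_high m b).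
  - destruct (profile_exists m E (proj1 HE)) as [v Hv].
    exists E, v. split; [|split; [exact Hv|split]].
    + destruct (proj1 HE) as [H | <-]; auto. exfalso. apply HnB.
      exists v. split; auto. exists 1, 2. split; [lra|].
      now apply (profile_increases_low m 0).
    + intros r Hr. apply Rnot_lt_le. intro H. apply HnA. exists v. split; auto. now exists r.
    + intros a c [Ha [Hac | ->]]; [|lra]. apply Rnot_lt_le. intro H. apply HnB.
      exists v. split; auto. exists a, c. split; auto.
Qed.

(** * Existence *)

Lemma is_derive_pow_pos (m : nat) (r : R) : 0 < r ->
  is_derive (fun x => x ^ m) r (INR m / r * r ^ m).
Proof.
  intros Hr. auto_derive; auto. destruct m as [|m]; [simpl; field; lra|].
  simpl pred. rewrite <- tech_pow_Rmult. field. lra.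
Qed.

Lemma is_derive_dilate (f : R -> R) (l r d : R) :
  is_derive f (l * r) d -> is_derive (fun x => f (l * x)) r (l * d).
Proof.
  intros Hf. apply (is_derive_comp f (fun x => l * x)); [exact Hf|].
  auto_derive; auto. ring.
Qed.

Lemma is_derive_Rscal (f : R -> R) (c r d : R) :
  is_derive f r d -> is_derive (fun x => c * f x) r (c * d).
Proof. intros Hf. exact (is_derive_scal f r c d Hf). Qed.

Lemma Derive_pos (f df ddf : R -> R) :
  (forall r, 0 < r -> is_derive f r (df r)) ->
  (forall r, 0 < r -> is_derive df r (ddf r)) ->
  forall r, 0 < r -> Derive f r = df r /\ is_derive (Derive f) r (ddf r).
Proof.
  intros Hf Hdf r Hr. split; [apply is_derive_unique, Hf, Hr|].
  apply (is_derive_ext_loc df); [|apply Hdf, Hr].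
  exists (mkposreal r Hr). intros y Hy. change (Rabs (y - r) < r) in Hy.
  apply Rabs_def2 in Hy. symmetry. apply is_derive_unique, Hf. lra.
Qed.

Lemma continuous_at_right (f : R -> R) (x : R) : continuous f x ->
  filterlim f (at_right x) (locally (f x)).
Proof.
  intros Hf. refine (filterlim_filter_le_1 _ _ Hf).
  apply filter_le_within.
Qed.

Lemma radial_exists (m : nat) : exists u W, is_radial_solution m u W.
Proof.
  destruct (shooting m) as [E [v [HE [Hprof [Hnn Hdecr]]]]].
  set (k := (2 * m + 1)%nat).
  set (l := / sqrt E).
  assert (Hl : 0 < l) by (apply Rinv_0_lt_compat, sqrt_lt_R0, HE).
  assert (HlE : l ^ 2 * E = 1).
  { unfold l. rewrite pow_inv, pow2_sqrt by lra. field. lra. }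
  set (dv := slope k (force m E v)).
  set (W0 := potential m v).
  set (dW := slope 1 (density m v)).
  assert (Hcl : forall r, 0 <= r -> clamp (v r) = v r) by (intros; now apply (profile_clamp m E)).
  assert (Hv : forall r, is_derive v r (dv r)) by (intro; now apply profile_derive).
  assert (Hdv : forall r, 0 < r -> is_derive dv r ((W0 r - E) * v r - INR k / r * dv r)).
  { intros r Hr. rewrite <- (Hcl r) by lra.
    apply is_derive_slope; [apply continuous_force, Hprof | exact Hr]. }
  assert (HW : forall r, is_derive W0 r (dW r)) by (intro; now apply (potential_derive m E)).
  assert (HdW : forall r, 0 < r -> is_derive dW r (r ^ (2 * m) * v r ^ 2 - / r * dW r)).
  { intros r Hr. rewrite <- (Hcl r) by lra.
    replace (/ r) with (INR 1 / r) by (simpl; field; lra).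
    apply is_derive_slope; [apply continuous_density, Hprof | exact Hr]. }
  set (u := fun r => l ^ 2 * ((l * r) ^ m * v (l * r))).
  set (W := fun r => l ^ 2 * W0 (l * r)).
  set (du := fun r => INR m * (/ r * u r) + l ^ 3 * ((l * r) ^ m * dv (l * r))).
  assert (Hpow : forall r, 0 < r -> is_derive (fun x => (l * x) ^ m) r (INR m / r * (l * r) ^ m)).
  { intros r Hr. replace (INR m / r * (l * r) ^ m) with (l * (INR m / (l * r) * (l * r) ^ m)) by (field; lra).
    apply (is_derive_dilate (fun x => x ^ m)), is_derive_pow_pos, Rmult_lt_0_compat; auto. }
  assert (Hu1 : forall r, 0 < r -> is_derive u r (du r)).
  { intros r Hr. unfold u, du.
    replace (INR m * (/ r * u r) + l ^ 3 * ((l * r) ^ m * dv (l * r)))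
      with (l ^ 2 * (INR m / r * (l * r) ^ m * v (l * r) + (l * r) ^ m * (l * dv (l * r))))
      by (unfold u; field; lra).
    apply is_derive_Rscal.
    apply (is_derive_Rmult (fun x => (l * x) ^ m) (fun x => v (l * x))); [now apply Hpow|].
    apply is_derive_dilate, Hv. }
  assert (Hu2 : forall r, 0 < r -> is_derive du r
     ((W r - 1) * u r + INR m ^ 2 / r ^ 2 * u r - / r * du r)).
  { intros r Hr. evar_last.
    - apply (is_derive_Rplus (fun r => INR m * (/ r * u r)) (fun r => l ^ 3 * ((l * r) ^ m * dv (l * r)))).
      + apply is_derive_Rscal. apply (is_derive_Rmult Rinv u); [|now apply Hu1].
        apply (is_derive_inv (fun x => x)); [apply (is_derive_id r) | lra].
      + apply is_derive_Rscal.
        apply (is_derive_Rmult (fun x => (l * x) ^ m) (fun x => dv (l * x))); [now apply Hpow|].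
        apply is_derive_dilate, Hdv, Rmult_lt_0_compat; auto.
    - change one with 1. unfold W.
      (* Here [l ^ 2 * E = 1] turns the parameter back into the eigenvalue 1. *)
      replace (l ^ 2 * W0 (l * r) - 1) with (l ^ 2 * (W0 (l * r) - E)) by lra.
      unfold du, u, k. rewrite plus_INR, mult_INR.
      replace (INR 2) with 2 by (simpl; ring). replace (INR 1) with 1 by reflexivity.
      field. split; lra. }
  assert (HW1 : forall r, is_derive W r (l ^ 3 * dW (l * r))).
  { intros r. replace (l ^ 3 * dW (l * r)) with (l ^ 2 * (l * dW (l * r))) by ring.
    apply is_derive_Rscal, is_derive_dilate, HW. }
  assert (HW2 : forall r, 0 < r -> is_derive (fun x => l ^ 3 * dW (l * x)) r
     (Rabs (u r) ^ 2 - / r * (l ^ 3 * dW (l * r)))).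
  { intros r Hr. rewrite pow2_abs.
    evar_last.
    - apply is_derive_Rscal, is_derive_dilate, HdW, Rmult_lt_0_compat; auto.
    - unfold u. rewrite pow_mult.
      replace (((l * r) ^ 2) ^ m) with ((l * r) ^ m * (l * r) ^ m)
        by (rewrite <- Rpow_mult_distr; f_equal; ring).
      field. split; lra. }
  assert (HDW : forall r, Derive W r = l ^ 3 * dW (l * r)) by (intro; apply is_derive_unique, HW1).
  assert (HdW0 : dW (l * 0) = 0).
  { apply slope_nonpos. rewrite Rmult_0_r. lra. }
  assert (HW0 : W 0 = 0).
  { unfold W, W0, potential. rewrite Rmult_0_r, J_0. ring. }
  pose proof (Derive_pos u du _ Hu1 Hu2) as HU.
  pose proof (Derive_pos W _ _ (fun r _ => HW1 r) HW2) as HWW.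
  assert (Hlin : forall x, continuous (fun x => l * x) x).
  { intro x. apply (ex_derive_continuous (fun x => l * x)). auto_derive; auto. }
  exists u, W. unfold is_radial_solution.
  split; [intros r Hr; repeat split | repeat apply conj].
  - eexists; now apply Hu1.
  - eexists; now apply HU.
  - eexists; apply HW1.
  - eexists; now apply HWW.
  - intros r Hr. destruct (HU r Hr) as [-> H]. rewrite (is_derive_unique _ _ _ H).
    unfold Rdiv. ring.
  - intros r Hr. destruct (HWW r Hr) as [-> H]. rewrite (is_derive_unique _ _ _ H). ring.
  - apply continuous_at_right.
    apply (continuous_mult (fun _ => l ^ 2) (fun x => (l * x) ^ m * v (l * x))); [apply continuous_const|].
    apply (continuous_comp (fun x => l * x) (fun x => x ^ m * v x)); [apply Hlin|].
    apply continuous_weight, Hprof.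
  - exact HW0.
  (* As [J] is extended by 0 to the left, [W] has a two-sided derivative 0 at the origin, which
     gives the one-sided difference quotient. *)
  - intros P [eps HP].
    assert (H0 := HW1 0). rewrite HdW0, Rmult_0_r in H0. apply is_derive_Reals in H0.
    destruct (H0 eps (cond_pos eps)) as [d Hd].
    exists d. intros y Hy Hy0. change (Rabs (y - 0) < d) in Hy. rewrite Rminus_0_r in Hy.
    apply HP. specialize (Hd y ltac:(lra) Hy). rewrite Rplus_0_l in Hd. exact Hd.
  - apply (filterlim_ext (fun x => l ^ 3 * dW (l * x))); [intro; now rewrite HDW|].
    assert (Hz : l ^ 3 * dW (l * 0) = 0) by (rewrite HdW0; ring). rewrite <- Hz at 2.
    apply (continuous_at_right (fun x => l ^ 3 * dW (l * x)) 0).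
    apply (continuous_mult (fun _ => l ^ 3) (fun x => dW (l * x))); [apply continuous_const|].
    apply (continuous_comp (fun x => l * x) dW); [apply Hlin|].
    apply continuous_slope, continuous_density, Hprof.
  - intros r Hr. assert (0 < l * r) by now apply Rmult_lt_0_compat.
    apply Rmult_lt_0_compat; [now apply pow_lt|].
    apply Rmult_lt_0_compat; [now apply pow_lt|].
    apply (profile_pos m E); auto. lra.
  - replace (Finite 0) with (Rbar_mult (l ^ 2) 0) by (simpl; f_equal; ring).
    apply (is_lim_scal_l (fun r => (l * r) ^ m * v (l * r))).
    apply (is_lim_comp (fun x => x ^ m * v x) (fun r => l * r) p_infty 0 p_infty).
    + now apply (profile_decay m E).
    + replace p_infty with (Rbar_mult l p_infty) at 2.
      * apply (is_lim_scal_l (fun r => r)), is_lim_id.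
      * apply is_Rbar_mult_unique. now apply is_Rbar_mult_sym, is_Rbar_mult_p_infty_pos.
    + exists 0. intros; discriminate.
Qed.

(** * Limits at the origin *)

Definition lim0 (f : R -> R) (l : R) : Prop := filterlim f (at_right 0) (locally l).

Lemma lim0_spec (f : R -> R) (l : R) : lim0 f l <->
  forall eps, 0 < eps -> exists d, 0 < d /\ forall r, 0 < r < d -> Rabs (f r - l) < eps.
Proof.
  split.
  - intros H eps He.
    destruct (proj1 (filterlim_locally _ _) H (mkposreal eps He)) as [d Hd].
    exists d. split; [apply cond_pos|]. intros r Hr. apply (Hd r); [|lra].
    change (Rabs (r - 0) < d). apply Rabs_def1; lra.
  - intros H. apply filterlim_locally. intros [eps He]. destruct (H eps He) as [d [Hd Hf]].
    exists (mkposreal d Hd). intros y Hy Hy0. change (Rabs (y - 0) < d) in Hy.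
    apply Rabs_def2 in Hy. apply (Hf y). lra.
Qed.

Lemma lim0_ext (f g : R -> R) (l : R) : (forall r, 0 < r -> f r = g r) -> lim0 f l -> lim0 g l.
Proof.
  intros Hfg Hf. apply lim0_spec. intros eps He.
  destruct (proj1 (lim0_spec f l) Hf eps He) as [d [Hd H]].
  exists d. split; auto. intros r Hr. rewrite <- Hfg by lra. now apply H.
Qed.

Lemma lim0_const (c : R) : lim0 (fun _ => c) c.
Proof. apply filterlim_const. Qed.

Lemma lim0_plus (f g : R -> R) (a b : R) : lim0 f a -> lim0 g b -> lim0 (fun r => f r + g r) (a + b).
Proof. intros Hf Hg. exact (filterlim_comp_2 _ _ _ Hf Hg (filterlim_plus a b)). Qed.

Lemma lim0_mult (f g : R -> R) (a b : R) : lim0 f a -> lim0 g b -> lim0 (fun r => f r * g r) (a * b).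
Proof. intros Hf Hg. exact (filterlim_comp_2 _ _ _ Hf Hg (filterlim_mult a b)). Qed.

Lemma lim0_opp (f : R -> R) (a : R) : lim0 f a -> lim0 (fun r => - f r) (- a).
Proof. intros Hf. exact (filterlim_comp _ _ _ _ _ _ _ _ Hf (filterlim_opp a)). Qed.

Lemma lim0_minus (f g : R -> R) (a b : R) : lim0 f a -> lim0 g b -> lim0 (fun r => f r - g r) (a - b).
Proof. intros Hf Hg. apply lim0_plus; [exact Hf | now apply lim0_opp]. Qed.

Lemma lim0_pow (n : nat) : lim0 (fun r => r ^ S n) 0.
Proof.
  replace 0 with (0 ^ S n) by (simpl; ring).
  apply (continuous_at_right (fun r => r ^ S n)), continuous_Rpow.
Qed.

Lemma lim0_unique (f : R -> R) (a b : R) : lim0 f a -> lim0 f b -> a = b.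
Proof. exact (filterlim_locally_unique (V := R_NormedModule) (F := at_right 0) f a b). Qed.

Lemma lim0_le_of_derive (f df : R -> R) (l b r : R) : lim0 f l -> 0 < r < b ->
  (forall x, 0 < x < b -> is_derive f x (df x)) ->
  (forall x, 0 < x < b -> 0 <= df x) -> l <= f r.
Proof.
  intros Hl Hr Hd Hp. apply Rnot_lt_le. intro Hlt.
  destruct (proj1 (lim0_spec f l) Hl (l - f r) ltac:(lra)) as [d [Hd0 H]].
  set (s := Rmin (d / 2) r).
  pose proof (Rmin_l (d / 2) r : s <= _). pose proof (Rmin_r (d / 2) r : s <= _).
  assert (0 < s) by (apply Rmin_glb_lt; lra).
  specialize (H s ltac:(lra)). apply Rabs_def2 in H.
  assert (f s <= f r); [|lra].
  apply (derive_nonneg_le f df); auto; intros; [apply Hd | apply Hp]; lra.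
Qed.

Lemma lim0_lt_of_derive (f df : R -> R) (l b r : R) : lim0 f l -> 0 < r < b ->
  (forall x, 0 < x < b -> is_derive f x (df x)) ->
  (forall x, 0 < x < b -> 0 < df x) -> l < f r.
Proof.
  intros Hl Hr Hd Hp.
  apply (Rle_lt_trans _ (f (r / 2))).
  - apply (lim0_le_of_derive f df l b); auto; [lra|]. intros; left; auto.
  - apply (derive_pos_lt f df); [lra| |]; intros; [apply Hd | apply Hp]; lra.
Qed.

Lemma lim0_gt_of_derive (f df : R -> R) (l b r : R) : lim0 f l -> 0 < r < b ->
  (forall x, 0 < x < b -> is_derive f x (df x)) ->
  (forall x, 0 < x < b -> df x < 0) -> f r < l.
Proof.
  intros Hl Hr Hd Hp.
  cut (- l < - f r); [lra|].
  apply (lim0_lt_of_derive (fun x => - f x) (fun x => - df x) (- l) b); auto.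
  - now apply lim0_opp.
  - intros x Hx. apply (is_derive_opp f x (df x)). now apply Hd.
  - intros x Hx. specialize (Hp x Hx). lra.
Qed.

Lemma lim0_of_nonincreasing_bounded (f : R -> R) (b C : R) : 0 < b ->
  (forall x y, 0 < x <= y -> y < b -> f y <= f x) -> (forall x, 0 < x < b -> f x <= C) ->
  exists l, lim0 f l /\ forall x, 0 < x < b -> f x <= l.
Proof.
  intros Hb Hm HC.
  set (S := fun y => exists x, 0 < x < b /\ y = f x).
  destruct (completeness S) as [l [Hub Hlub]].
  - exists C. intros y [x [Hx ->]]. now apply HC.
  - exists (f (b / 2)), (b / 2). split; [lra | reflexivity].
  - exists l. assert (Hle : forall x, 0 < x < b -> f x <= l).
    { intros x Hx. apply Hub. now exists x. }
    split; [|exact Hle]. apply lim0_spec. intros eps He.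
    assert (Hex : exists x, 0 < x < b /\ l - eps < f x).
    { apply NNPP. intro Hn. assert (l <= l - eps); [|lra]. apply Hlub.
      intros y [x [Hx ->]]. apply Rnot_lt_le. intro H. apply Hn. now exists x. }
    destruct Hex as [x [Hx Hfx]]. exists x. split; [lra|]. intros r Hr.
    pose proof (Hle r ltac:(lra)). pose proof (Hm r x ltac:(lra) ltac:(lra)).
    apply Rabs_def1; lra.
Qed.

Lemma lim0_bounded (f : R -> R) (l b : R) : lim0 f l -> (forall r, 0 < r -> continuous f r) ->
  exists C, 0 <= C /\ forall r, 0 < r <= b -> Rabs (f r) <= C.
Proof.
  intros Hl Hc. destruct (proj1 (lim0_spec f l) Hl 1 ltac:(lra)) as [d [Hd H]].
  destruct (Rle_lt_dec b (d / 2)) as [Hbd|Hbd].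
  - exists (Rabs l + 1). split; [pose proof (Rabs_pos l); lra|].
    intros r Hr. specialize (H r ltac:(lra)).
    replace (f r) with (l + (f r - l)) by ring. eapply Rle_trans; [apply Rabs_triang|]. lra.
  - destruct (continuity_ab_maj (fun t => Rabs (f t)) (d / 2) b ltac:(lra)) as [M [HM _]].
    { intros c Hcc. apply continuity_pt_filterlim.
      apply (continuous_comp f Rabs); [apply Hc; lra | apply continuous_Rabs]. }
    exists (Rabs l + 1 + Rabs (f M)).
    pose proof (Rabs_pos l). pose proof (Rabs_pos (f M)). split; [lra|].
    intros r Hr. destruct (Rlt_le_dec r d) as [Hrd|Hrd].
    + specialize (H r ltac:(lra)).
      replace (f r) with (l + (f r - l)) by ring. eapply Rle_trans; [apply Rabs_triang|]. lra.
    + specialize (HM r ltac:(lra)). lra.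
Qed.

(** [r ^ k] is the integrating factor that absorbs the singular first-order term. *)
Lemma is_derive_flux (k : nat) (f : R -> R) (r c : R) : 0 < r ->
  is_derive f r (c - INR k / r * f r) -> is_derive (fun x => x ^ k * f x) r (r ^ k * c).
Proof.
  intros Hr Hf.
  replace (r ^ k * c) with (INR k / r * r ^ k * f r + r ^ k * (c - INR k / r * f r)) by ring.
  apply (is_derive_Rmult (fun x => x ^ k) f); [now apply is_derive_pow_pos | exact Hf].
Qed.

(** * Comparison of regular profiles *)

(* The system for [v = u / r^m], regular at the origin with [v(0+) = a]. *)
Definition regular_profile (m : nat) (v dv W dW : R -> R) (a : R) : Prop :=
  (forall r, 0 < r -> is_derive v r (dv r)) /\
  (forall r, 0 < r -> is_derive dv r ((W r - 1) * v r - INR (2 * m + 1) / r * dv r)) /\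
  (forall r, 0 < r -> is_derive W r (dW r)) /\
  (forall r, 0 < r -> is_derive dW r (r ^ (2 * m) * v r ^ 2 - INR 1 / r * dW r)) /\
  (forall r, 0 < r -> 0 < v r) /\
  (lim0 v a /\ lim0 dv 0 /\ lim0 W 0 /\ lim0 dW 0).

Lemma young (x y c A : R) : Rabs c <= A -> 2 * (c * x * y) <= A * (x ^ 2 + y ^ 2).
Proof.
  intros Hc. apply Rabs_le_between in Hc.
  assert (0 <= (A - c) * (x + y) ^ 2) by (apply Rmult_le_pos; [lra | apply pow2_ge_0]).
  assert (0 <= (A + c) * (x - y) ^ 2) by (apply Rmult_le_pos; [lra | apply pow2_ge_0]).
  nra.
Qed.

Lemma is_derive_sq (f : R -> R) (x d : R) : is_derive f x d ->
  is_derive (fun t => f t ^ 2) x (2 * f x * d).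
Proof.
  intros Hf. replace (2 * f x * d) with (INR 2 * d * f x ^ pred 2) by (simpl; ring).
  now apply (is_derive_pow f 2 x).
Qed.

Lemma lim0_sq (f : R -> R) : lim0 f 0 -> lim0 (fun r => f r ^ 2) 0.
Proof.
  intros Hf. apply (lim0_ext (fun r => f r * f r)); [intros; ring|].
  replace 0 with (0 * 0) by ring. now apply lim0_mult.
Qed.

Lemma regular_profile_unique (m : nat) (v1 dv1 W1 dW1 v2 dv2 W2 dW2 : R -> R) (a : R) :
  regular_profile m v1 dv1 W1 dW1 a -> regular_profile m v2 dv2 W2 dW2 a ->
  forall r, 0 < r -> v1 r = v2 r /\ W1 r = W2 r.
Proof.
  intros [Hv1 [Hd1 [HW1 [HdW1 [_ [Lv1 [Ld1 [LW1 LdW1]]]]]]]]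
    [Hv2 [Hd2 [HW2 [HdW2 [_ [Lv2 [Ld2 [LW2 LdW2]]]]]]]] b Hb.
  assert (Hcont : forall f df : R -> R, (forall r, 0 < r -> is_derive f r (df r)) ->
    forall r, 0 < r -> continuous f r).
  { intros f df Hf r Hr. apply (ex_derive_continuous f). eexists. now apply Hf. }
  destruct (lim0_bounded v1 a b Lv1 (Hcont _ _ Hv1)) as [C1 [HC1 B1]].
  destruct (lim0_bounded v2 a b Lv2 (Hcont _ _ Hv2)) as [C2 [HC2 B2]].
  destruct (lim0_bounded W1 0 b LW1 (Hcont _ _ HW1)) as [C3 [HC3 B3]].
  assert (Hbm : 0 <= b ^ (2 * m)) by (apply pow_le; lra).
  (* Each summand bounds one coupling: the difference of the densities, the factor [v2] in front of
     [W1 - W2], and the factor [W1 - 1] in front of [v1 - v2]. *)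
  set (A := b ^ (2 * m) * (C1 + C2) + C2 + C3 + 1).
  assert (HA0 : 0 <= b ^ (2 * m) * (C1 + C2)) by (apply Rmult_le_pos; lra).
  set (e := fun r => (v1 r - v2 r) ^ 2 + (dv1 r - dv2 r) ^ 2 + (W1 r - W2 r) ^ 2 + (dW1 r - dW2 r) ^ 2).
  set (de := fun r => 2 * (v1 r - v2 r) * (dv1 r - dv2 r)
    + 2 * (dv1 r - dv2 r) * ((W1 r - 1) * v1 r - INR (2 * m + 1) / r * dv1 r
        - ((W2 r - 1) * v2 r - INR (2 * m + 1) / r * dv2 r))
    + 2 * (W1 r - W2 r) * (dW1 r - dW2 r)
    + 2 * (dW1 r - dW2 r) * (r ^ (2 * m) * v1 r ^ 2 - INR 1 / r * dW1 r
        - (r ^ (2 * m) * v2 r ^ 2 - INR 1 / r * dW2 r))).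
  assert (He : forall r, 0 < r -> is_derive e r (de r)).
  { intros r Hr. unfold e, de.
    apply is_derive_Rplus; [apply is_derive_Rplus; [apply is_derive_Rplus|]|].
    - apply (is_derive_sq (fun r => v1 r - v2 r)), is_derive_Rminus; auto.
    - apply (is_derive_sq (fun r => dv1 r - dv2 r)), is_derive_Rminus; auto.
    - apply (is_derive_sq (fun r => W1 r - W2 r)), is_derive_Rminus; auto.
    - apply (is_derive_sq (fun r => dW1 r - dW2 r)), is_derive_Rminus; auto. }
  assert (Hde : forall r, 0 < r <= b -> de r <= (1 + 2 * A) * e r).
  { intros r Hr. specialize (B1 r Hr). specialize (B2 r Hr). specialize (B3 r Hr).
    assert (Hrm : 0 <= r ^ (2 * m) <= b ^ (2 * m)).
    { split; [apply pow_le; lra | apply pow_incr; lra]. }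
    set (p := v1 r - v2 r). set (s := dv1 r - dv2 r). set (x := W1 r - W2 r). set (y := dW1 r - dW2 r).
    assert (Y0 := young p s 1 1 ltac:(rewrite Rabs_R1; lra)).
    assert (Y1 := young s p (W1 r - 1) A
      ltac:(apply Rabs_le_between in B3; apply Rabs_le; unfold A; lra)).
    assert (Y2 := young s x (v2 r) A ltac:(unfold A; lra)).
    assert (Y3 := young x y 1 1 ltac:(rewrite Rabs_R1; lra)).
    assert (Y4 : 2 * (r ^ (2 * m) * (v1 r + v2 r) * y * p) <= A * (y ^ 2 + p ^ 2)).
    { apply young. rewrite Rabs_mult, (Rabs_pos_eq (r ^ _)) by lra.
      assert (Hs : Rabs (v1 r + v2 r) <= C1 + C2) by (eapply Rle_trans; [apply Rabs_triang | lra]).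
      assert (r ^ (2 * m) * Rabs (v1 r + v2 r) <= b ^ (2 * m) * (C1 + C2)).
      { apply Rmult_le_compat; try lra. apply Rabs_pos. }
      unfold A. lra. }
    assert (Hk : 0 <= INR (2 * m + 1) / r * s ^ 2).
    { apply Rmult_le_pos; [|apply pow2_ge_0].
      apply Rmult_le_pos; [apply pos_INR|]. left; apply Rinv_0_lt_compat; lra. }
    assert (Hk1 : 0 <= INR 1 / r * y ^ 2).
    { apply Rmult_le_pos; [|apply pow2_ge_0].
      apply Rmult_le_pos; [apply pos_INR|]. left; apply Rinv_0_lt_compat; lra. }
    replace (de r) with (2 * (1 * p * s) + 2 * ((W1 r - 1) * s * p) + 2 * (v2 r * s * x)
      + 2 * (1 * x * y) + 2 * (r ^ (2 * m) * (v1 r + v2 r) * y * p)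
      - 2 * (INR (2 * m + 1) / r * s ^ 2) - 2 * (INR 1 / r * y ^ 2))
      by (unfold de, p, s, x, y; ring).
    replace (e r) with (p ^ 2 + s ^ 2 + x ^ 2 + y ^ 2) by reflexivity.
    assert (HA : 0 <= A) by (unfold A; lra).
    pose proof (Rmult_le_pos _ _ HA (pow2_ge_0 x)). pose proof (Rmult_le_pos _ _ HA (pow2_ge_0 y)).
    lra. }
  assert (Le : lim0 e 0).
  { unfold e. replace 0 with (0 + 0 + 0 + 0) by ring.
    repeat apply lim0_plus; apply lim0_sq.
    - replace 0 with (a - a) by ring. now apply lim0_minus.
    - replace 0 with (0 - 0) by ring. now apply lim0_minus.
    - replace 0 with (0 - 0) by ring. now apply lim0_minus.
    - replace 0 with (0 - 0) by ring. now apply lim0_minus. }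
  set (M := exp ((1 + 2 * A) * b)).
  assert (HM : 0 < M) by apply exp_pos.
  assert (Heb : e b <= 0).
  { apply Rnot_lt_le. intro Hpos.
    destruct (proj1 (lim0_spec e 0) Le (e b / M)) as [d [Hd H]].
    { apply Rmult_lt_0_compat; [exact Hpos | now apply Rinv_0_lt_compat]. }
    set (s := Rmin (d / 2) (b / 2)).
    pose proof (Rmin_l (d / 2) (b / 2) : s <= _). pose proof (Rmin_r (d / 2) (b / 2) : s <= _).
    assert (0 < s) by (apply Rmin_glb_lt; lra).
    specialize (H s ltac:(lra)). rewrite Rminus_0_r in H. apply Rabs_def2 in H.
    assert (Hg : e b <= e s * exp ((1 + 2 * A) * (b - s))).
    { apply (gronwall_forward e de); [lra| |]; intros; [apply He | apply Hde]; lra. }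
    assert (Hes : 0 <= e s).
    { unfold e. pose proof (pow2_ge_0 (v1 s - v2 s)). pose proof (pow2_ge_0 (dv1 s - dv2 s)).
      pose proof (pow2_ge_0 (W1 s - W2 s)). pose proof (pow2_ge_0 (dW1 s - dW2 s)). lra. }
    assert (exp ((1 + 2 * A) * (b - s)) <= M).
    { left. apply exp_increasing. apply Rmult_lt_compat_l; [unfold A; lra | lra]. }
    assert (e s * exp ((1 + 2 * A) * (b - s)) <= e s * M) by (apply Rmult_le_compat_l; lra).
    assert (e s * M < e b); [|lra].
    replace (e b) with (e b / M * M) by (field; lra). apply Rmult_lt_compat_r; lra. }
  unfold e in Heb.
  pose proof (pow2_ge_0 (v1 b - v2 b)). pose proof (pow2_ge_0 (dv1 b - dv2 b)).
  pose proof (pow2_ge_0 (W1 b - W2 b)). pose proof (pow2_ge_0 (dW1 b - dW2 b)).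
  assert (Hz : forall z, z ^ 2 = 0 -> z = 0).
  { intros z Hz. apply Rsqr_eq_0. unfold Rsqr. lra. }
  split; apply Rminus_diag_uniq, Hz; lra.
Qed.

(** * Wronskian comparison of two regular profiles *)

Section Comparison.

Variables (m : nat) (v1 dv1 W1 dW1 v2 dv2 W2 dW2 : R -> R) (a1 a2 : R).
Hypothesis P1 : regular_profile m v1 dv1 W1 dW1 a1.
Hypothesis P2 : regular_profile m v2 dv2 W2 dW2 a2.

Let k := (2 * m + 1)%nat.
Let F := fun r => r ^ k * (dv1 r * v2 r - v1 r * dv2 r).

Lemma wronskian_derive (r : R) : 0 < r ->
  is_derive F r (r ^ k * (v1 r * v2 r * (W1 r - W2 r))).
Proof.
  intros Hr. destruct P1 as [Hv1 [Hd1 _]], P2 as [Hv2 [Hd2 _]].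
  apply (is_derive_flux k (fun r => dv1 r * v2 r - v1 r * dv2 r)); auto.
  evar_last.
  - apply (is_derive_Rminus (fun r => dv1 r * v2 r) (fun r => v1 r * dv2 r)).
    + apply (is_derive_Rmult dv1 v2); auto.
    + apply (is_derive_Rmult v1 dv2); auto.
  - fold k. ring.
Qed.

(** The denominator is [r * u2 ^ 2] with [u2 = r ^ m * v2], because it is [u2] that tends to 0 at
    infinity. *)
Lemma ratio_derive (r : R) : 0 < r ->
  is_derive (fun r => v1 r / v2 r) r (F r / (r * (r ^ m * v2 r) ^ 2)).
Proof.
  intros Hr. destruct P1 as [Hv1 _], P2 as [Hv2 [_ [_ [_ [Hp2 _]]]]].
  specialize (Hp2 r Hr).
  evar_last.
  - apply is_derive_div; [now apply Hv1 | now apply Hv2 | lra].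
  - unfold F, k. rewrite pow_add, pow_1, Nat.mul_comm, pow_mult. field.
    assert (0 < r ^ m) by (apply pow_lt, Hr). repeat split; lra.
Qed.

Lemma wronskian_lim0 : lim0 F 0.
Proof.
  destruct P1 as [_ [_ [_ [_ [_ [L1 [D1 _]]]]]]], P2 as [_ [_ [_ [_ [_ [L2 [D2 _]]]]]]].
  unfold F. replace 0 with (0 * (0 * a2 - a1 * 0)) by ring.
  apply lim0_mult.
  - unfold k. rewrite Nat.add_1_r. apply lim0_pow.
  - apply lim0_minus; now apply lim0_mult.
Qed.

(** The same argument twice: [r * (W1' - W2')], and then [W1 - W2], has limit 0 at the origin and a
    negative derivative. *)
Lemma ordered_potential (b : R) : (forall x, 0 < x < b -> v1 x < v2 x) ->
  forall x, 0 < x < b -> W1 x < W2 x.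
Proof.
  intros Hlt x Hx.
  destruct P1 as [_ [_ [HW1 [HdW1 [Hp1 [_ [_ [LW1 LdW1]]]]]]]],
    P2 as [_ [_ [HW2 [HdW2 [Hp2 [_ [_ [LW2 LdW2]]]]]]]].
  assert (Hd : forall y, 0 < y < b -> dW1 y - dW2 y < 0).
  { intros y Hy. cut (y ^ 1 * (dW1 y - dW2 y) < 0); [rewrite pow_1; nra|].
    apply (lim0_gt_of_derive (fun r => r ^ 1 * (dW1 r - dW2 r))
      (fun r => r ^ 1 * (r ^ (2 * m) * v1 r ^ 2 - r ^ (2 * m) * v2 r ^ 2)) 0 b); auto.
    - replace 0 with (0 * (0 - 0)) by ring. apply lim0_mult; [apply (lim0_pow 0)|].
      now apply lim0_minus.
    - intros z Hz. apply (is_derive_flux 1 (fun r => dW1 r - dW2 r)); [lra|].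
      evar_last; [apply is_derive_Rminus; [apply HdW1 | apply HdW2]; lra | ring].
    - intros z Hz. specialize (Hlt z Hz). specialize (Hp1 z ltac:(lra)).
      assert (0 < z ^ (2 * m)) by (apply pow_lt; lra).
      rewrite pow_1. assert (v1 z ^ 2 < v2 z ^ 2) by nra.
      assert (z ^ (2 * m) * v1 z ^ 2 < z ^ (2 * m) * v2 z ^ 2) by (apply Rmult_lt_compat_l; lra).
      nra. }
  cut (W1 x - W2 x < 0); [lra|].
  apply (lim0_gt_of_derive (fun r => W1 r - W2 r) (fun r => dW1 r - dW2 r) 0 b); auto.
  - replace 0 with (0 - 0) by ring. now apply lim0_minus.
  - intros y Hy. apply is_derive_Rminus; [apply HW1 | apply HW2]; lra.
Qed.

Lemma ordered_wronskian (b : R) : (forall x, 0 < x < b -> v1 x < v2 x) ->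
  (forall x, 0 < x < b -> F x < 0) /\ (forall x y, 0 < x <= y -> y < b -> F y <= F x).
Proof.
  intros Hlt. pose proof (ordered_potential b Hlt) as HW.
  assert (Hneg : forall z, 0 < z < b -> z ^ k * (v1 z * v2 z * (W1 z - W2 z)) < 0).
  { intros z Hz. specialize (HW z Hz).
    destruct P1 as [_ [_ [_ [_ [Hp1 _]]]]], P2 as [_ [_ [_ [_ [Hp2 _]]]]].
    specialize (Hp1 z ltac:(lra)). specialize (Hp2 z ltac:(lra)).
    assert (0 < z ^ k) by (apply pow_lt; lra).
    assert (0 < z ^ k * (v1 z * v2 z)) by (repeat apply Rmult_lt_0_compat; auto). nra. }
  split.
  - intros x Hx. apply (lim0_gt_of_derive F (fun z => z ^ k * (v1 z * v2 z * (W1 z - W2 z))) 0 b); auto.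
    + apply wronskian_lim0.
    + intros z Hz. apply wronskian_derive; lra.
  - intros x y Hxy Hy. apply (derive_nonpos_ge F (fun z => z ^ k * (v1 z * v2 z * (W1 z - W2 z)))); [lra| |].
    + intros z Hz. apply wronskian_derive; lra.
    + intros z Hz. left. apply Hneg; lra.
Qed.

Lemma ratio_slope_neg (x : R) : 0 < x -> F x < 0 -> F x / (x * (x ^ m * v2 x) ^ 2) < 0.
Proof.
  intros Hx HF. destruct P2 as [_ [_ [_ [_ [Hp2 _]]]]]. specialize (Hp2 x Hx).
  assert (0 < x ^ m * v2 x) by (apply Rmult_lt_0_compat; [now apply pow_lt | exact Hp2]).
  assert (0 < / (x * (x ^ m * v2 x) ^ 2)) by (apply Rinv_0_lt_compat, Rmult_lt_0_compat; nra).
  unfold Rdiv. nra.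
Qed.

(* The ratio v1/v2 is nonincreasing as long as it is below 1, so it never reaches 1. *)
Lemma profiles_ordered : a1 < a2 -> forall r, 0 < r -> v1 r < v2 r.
Proof.
  intros Ha r Hr. apply Rnot_le_lt. intro Hle.
  pose proof P1 as [Hv1 [_ [_ [_ [Hp1 [L1 _]]]]]]. pose proof P2 as [Hv2 [_ [_ [_ [Hp2 [L2 _]]]]]].
  assert (Ld : lim0 (fun r => v1 r - v2 r) (a1 - a2)) by now apply lim0_minus.
  destruct (proj1 (lim0_spec _ _) Ld (a2 - a1) ltac:(lra)) as [d [Hd H]].
  assert (Hnear : forall x, 0 < x < d -> v1 x < v2 x).
  { intros x Hx. specialize (H x Hx). apply Rabs_def2 in H. lra. }
  assert (Hdr : d <= r).
  { apply Rnot_lt_le. intro Hrd. specialize (Hnear r ltac:(lra)). lra. }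
  destruct (first_zero (fun x => v1 x - v2 x) (d / 2) r) as [s [Hs [Hvs Hbefore]]]; [lra| | |lra|].
  { intros x Hx. apply (ex_derive_continuous (fun x => v1 x - v2 x)). eexists.
    apply is_derive_Rminus; [apply Hv1 | apply Hv2]; lra. }
  { specialize (Hnear (d / 2) ltac:(lra)). lra. }
  assert (Hlt : forall x, 0 < x < s -> v1 x < v2 x).
  { intros x Hx. destruct (Rlt_le_dec x d) as [Hxd|Hxd]; [apply Hnear; lra|].
    specialize (Hbefore x ltac:(lra)). lra. }
  destruct (ordered_wronskian s Hlt) as [HF _].
  assert (Hq : v1 s / v2 s <= v1 (d / 2) / v2 (d / 2)).
  { apply (derive_nonpos_ge (fun r => v1 r / v2 r) (fun r => F r / (r * (r ^ m * v2 r) ^ 2))); [lra| |].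
    - intros x Hx. apply ratio_derive; lra.
    - intros x Hx. left. apply ratio_slope_neg; [lra|]. apply HF; lra. }
  replace (v1 s / v2 s) with 1 in Hq.
  - specialize (Hnear (d / 2) ltac:(lra)). specialize (Hp2 (d / 2) ltac:(lra)).
    apply (Rmult_le_compat_r (v2 (d / 2))) in Hq; [|lra].
    replace (v1 (d / 2) / v2 (d / 2) * v2 (d / 2)) with (v1 (d / 2)) in Hq by (field; lra). lra.
  - specialize (Hp2 s ltac:(lra)). replace (v1 s) with (v2 s) by lra. field. lra.
Qed.

(* [v1/v2] stays positive although its derivative is at most [-c/r] near infinity. *)
Lemma initial_values_not_lt : is_lim (fun r => r ^ m * v2 r) p_infty 0 -> ~ a1 < a2.
Proof.
  intros Hlim Ha. pose proof (profiles_ordered Ha) as Hord.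
  pose proof P1 as [_ [_ [_ [_ [Hp1 _]]]]]. pose proof P2 as [_ [_ [_ [_ [Hp2 _]]]]].
  assert (Hw : forall b, (forall x, 0 < x < b -> F x < 0) /\ (forall x y, 0 < x <= y -> y < b -> F y <= F x)).
  { intro b. apply ordered_wronskian. intros x Hx. apply Hord; lra. }
  (* [F] is nonincreasing, so [F x <= - c] beyond 1; once [u2 <= 1], dividing by [x * u2 ^ 2] gives
     the rate [- c / x]. *)
  set (c := - F 1).
  assert (Hc : 0 < c) by (pose proof (proj1 (Hw 2) 1 ltac:(lra)); unfold c; lra).
  apply is_lim_spec in Hlim. destruct (Hlim (mkposreal 1 Rlt_0_1)) as [M HM]. simpl in HM.
  set (R1 := Rmax 1 (M + 1)).
  assert (H1 : 1 <= R1) by apply Rmax_l. assert (H2 : M + 1 <= R1) by apply Rmax_r.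
  destruct (ln_unbounded_right R1 (v1 R1 / v2 R1 / c) ltac:(lra)) as [b [Hb Hln]].
  assert (Hg : c * (ln b - ln R1) <= - (v1 b / v2 b) - - (v1 R1 / v2 R1)).
  { apply (log_growth (fun r => - (v1 r / v2 r)) (fun r => - (F r / (r * (r ^ m * v2 r) ^ 2)))); try lra.
    - intros x Hx. apply (is_derive_opp (fun r => v1 r / v2 r)). apply ratio_derive; lra.
    - intros x Hx. pose proof (proj2 (Hw (x + 1)) 1 x ltac:(lra) ltac:(lra)) as HF.
      specialize (HM x ltac:(lra)). rewrite Rminus_0_r in HM. apply Rabs_def2 in HM.
      assert (Hu : 0 < x ^ m * v2 x).
      { apply Rmult_lt_0_compat; [apply pow_lt; lra | apply Hp2; lra]. }
      set (w := x ^ m * v2 x) in *.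
      assert (Hw2 : 0 < w ^ 2 <= 1) by (simpl; nra).
      apply (Rmult_le_reg_r (x * w ^ 2)); [apply Rmult_lt_0_compat; lra|].
      replace (c / x * (x * w ^ 2)) with (c * w ^ 2) by (field; lra).
      replace (- (F x / (x * w ^ 2)) * (x * w ^ 2)) with (- F x) by (field; lra).
      unfold c in *. nra. }
  apply (Rmult_lt_compat_l c) in Hln; auto.
  replace (c * (v1 R1 / v2 R1 / c)) with (v1 R1 / v2 R1) in Hln
    by (specialize (Hp2 R1 ltac:(lra)); field; lra).
  assert (0 < v1 b / v2 b).
  { apply Rmult_lt_0_compat; [|apply Rinv_0_lt_compat]; [apply Hp1 | apply Hp2]; lra. }
  lra.
Qed.

End Comparison.

(** * Regularity at the origin of a radial solution *)

Section Regularity.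

Variables (m : nat) (u W : R -> R).
Hypothesis Hsol : is_radial_solution m u W.

Let k := (2 * m + 1)%nat.
Let v := fun r => u r / r ^ m.
Let dv := fun r => (Derive u r - INR m * (/ r * u r)) / r ^ m.
Let G := fun r => r ^ k * dv r.

Lemma radial_u (r : R) : 0 < r -> u r = r ^ m * v r.
Proof. intros Hr. unfold v. field. apply pow_nonzero; lra. Qed.

Lemma radial_v_pos (r : R) : 0 < r -> 0 < v r.
Proof.
  intros Hr. apply Rmult_lt_0_compat; [now apply Hsol | now apply Rinv_0_lt_compat, pow_lt].
Qed.

Lemma radial_v_derive (r : R) : 0 < r -> is_derive v r (dv r).
Proof.
  intros Hr. destruct Hsol as [Hex _]. destruct (Hex r Hr) as [Hu _].
  evar_last.
  - apply is_derive_div; [apply Derive_correct, Hu | now apply is_derive_pow_pos |].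
    apply pow_nonzero; lra.
  - assert (Hrm : r ^ m <> 0) by (apply pow_nonzero; lra). unfold dv. field. now split; try lra.
Qed.

Lemma radial_dv_derive (r : R) : 0 < r ->
  is_derive dv r ((W r - 1) * v r - INR k / r * dv r).
Proof.
  intros Hr. destruct Hsol as [Hex [Heq _]]. destruct (Hex r Hr) as [Hu [Hdu _]].
  specialize (Heq r Hr).
  assert (Hrm : r ^ m <> 0) by (apply pow_nonzero; lra).
  evar_last.
  - apply (is_derive_div (fun r => Derive u r - INR m * (/ r * u r)) (fun r => r ^ m));
      [|now apply is_derive_pow_pos | exact Hrm].
    apply is_derive_Rminus; [apply Derive_correct, Hdu|].
    apply is_derive_Rscal. apply (is_derive_Rmult Rinv u); [|apply Derive_correct, Hu].
    apply (is_derive_inv (fun x => x)); [apply (is_derive_id r) | lra].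
  - change one with 1.
    replace (Derive (fun x => Derive u x) r) with (Derive (Derive u) r) by reflexivity.
    replace (Derive (Derive u) r)
      with ((W r - 1) * u r - / r * Derive u r + INR m ^ 2 / r ^ 2 * u r) by lra.
    unfold dv, v, k. rewrite plus_INR, mult_INR.
    replace (INR 2) with 2 by (simpl; ring). replace (INR 1) with 1 by reflexivity.
    field. now split; try lra.
Qed.

Lemma radial_flux_derive (r : R) : 0 < r -> is_derive G r (r ^ k * ((W r - 1) * v r)).
Proof. intros Hr. apply is_derive_flux; [exact Hr | now apply radial_dv_derive]. Qed.

Lemma radial_W_derive (r : R) : 0 < r -> is_derive W r (Derive W r).
Proof. intros Hr. apply Derive_correct, Hsol, Hr. Qed.

Lemma radial_dW_derive (r : R) : 0 < r ->
  is_derive (Derive W) r (r ^ (2 * m) * v r ^ 2 - INR 1 / r * Derive W r).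
Proof.
  intros Hr. destruct Hsol as [Hex [_ [Heq _]]]. specialize (Heq r Hr).
  evar_last; [apply Derive_correct, (Hex r Hr)|].
  rewrite pow2_abs, radial_u in Heq by exact Hr.
  replace (r ^ (2 * m) * v r ^ 2) with ((r ^ m * v r) ^ 2).
  - rewrite <- Heq. simpl INR. unfold Rdiv.
    replace (Derive (fun x => Derive W x) r) with (Derive (Derive W) r) by reflexivity. ring.
  - rewrite Nat.mul_comm, pow_mult. ring.
Qed.

Lemma radial_dW_lim0 : lim0 (Derive W) 0.
Proof. apply Hsol. Qed.

Lemma radial_W_lim0 : lim0 W 0.
Proof.
  destruct Hsol as [_ [_ [_ [_ [HW0 [HW _]]]]]].
  rewrite <- (Rmult_0_r 0).
  apply (lim0_ext (fun r => r ^ 1 * ((W r - W 0) / r))).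
  - intros r Hr. rewrite HW0. field. lra.
  - apply lim0_mult; [apply (lim0_pow 0) | exact HW].
Qed.

Lemma radial_W_nonneg (r : R) : 0 < r -> 0 <= W r.
Proof.
  intros Hr. apply (lim0_le_of_derive W (Derive W) 0 (r + 1)); [apply radial_W_lim0 | lra | |].
  - intros x Hx. apply radial_W_derive; lra.
  - intros x Hx. cut (0 <= x ^ 1 * Derive W x); [rewrite pow_1; nra|].
    apply (lim0_le_of_derive (fun x => x ^ 1 * Derive W x)
      (fun x => x ^ 1 * (x ^ (2 * m) * v x ^ 2)) 0 (r + 1)); auto.
    + replace 0 with (0 * 0) by ring. apply lim0_mult; [apply (lim0_pow 0) | apply radial_dW_lim0].
    + intros y Hy. apply is_derive_flux; [lra|]. apply radial_dW_derive; lra.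
    + intros y Hy. apply Rmult_le_pos; [apply pow_le; lra|].
      apply Rmult_le_pos; [apply pow_le; lra | apply pow2_ge_0].
Qed.

(** Below this radius [W - 1] is negative, which makes the flux decrease; [d <= 1] serves to compare
    powers of [r]. *)
Lemma radial_W_small : exists d, 0 < d <= 1 /\ forall r, 0 < r < d -> W r < 1.
Proof.
  destruct (proj1 (lim0_spec _ _) radial_W_lim0 1 ltac:(lra)) as [d [Hd H]].
  exists (Rmin d 1). split; [split; [apply Rmin_glb_lt; lra | apply Rmin_r]|].
  intros r Hr. pose proof (Rmin_l d 1). specialize (H r ltac:(lra)).
  apply Rabs_def2 in H. lra.
Qed.

Lemma radial_flux_mono (d x y : R) : (forall r, 0 < r < d -> W r < 1) ->
  0 < x <= y -> y < d -> G y <= G x.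
Proof.
  intros HW Hxy Hy.
  apply (derive_nonpos_ge G (fun r => r ^ k * ((W r - 1) * v r))); [lra| |].
  - intros r Hr. apply radial_flux_derive; lra.
  - intros r Hr. specialize (HW r ltac:(lra)). pose proof (radial_v_pos r ltac:(lra)).
    assert (0 <= r ^ k) by (apply pow_le; lra). assert ((W r - 1) * v r <= 0) by nra. nra.
Qed.

(** As [k >= 1], [r ^ k <= r] on [(0, 1]], so for every [m] a positive flux gives at least the
    non-integrable rate [c / r]. *)
Lemma dv_of_flux_le (c r : R) : 0 < r <= 1 -> 0 < c -> c <= G r -> c / r <= dv r.
Proof.
  intros Hr Hc HG. unfold G in HG.
  assert (Hp : 0 < r ^ k) by (apply pow_lt; lra).
  assert (Hpr : r ^ k <= r).
  { unfold k. rewrite pow_add, pow_1. assert (r ^ (2 * m) <= 1); [|nra].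
    rewrite <- (pow1 (2 * m)). apply pow_incr; lra. }
  apply (Rmult_le_reg_r r); [lra|]. unfold Rdiv. rewrite Rmult_assoc, Rinv_l by lra.
  assert (0 < dv r) by nra. nra.
Qed.

(* A positive flux at the origin would drive [v] to [-oo] there. *)
Lemma radial_flux_nonpos (d r : R) : d <= 1 -> (forall r, 0 < r < d -> W r < 1) ->
  0 < r < d -> G r <= 0.
Proof.
  intros Hd HW Hr. apply Rnot_lt_le. intro HG.
  destruct (ln_unbounded_left r (v r / G r) ltac:(lra)) as [b [Hb Hln]].
  assert (Hg : G r * (ln r - ln b) <= v r - v b).
  { apply (log_growth v dv); try lra.
    - intros x Hx. apply radial_v_derive; lra.
    - intros x Hx. apply dv_of_flux_le; [lra | exact HG |].
      apply (radial_flux_mono d); auto; lra. }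
  pose proof (radial_v_pos b ltac:(lra)).
  apply (Rmult_lt_compat_l (G r)) in Hln; auto.
  replace (G r * (v r / G r)) with (v r) in Hln by (field; lra). lra.
Qed.

Lemma radial_u_bounded : exists C d, 0 < C /\ 0 < d /\ forall r, 0 < r < d -> u r <= C.
Proof.
  destruct Hsol as [_ [_ [_ [Hu _]]]].
  destruct (proj1 (lim0_spec u (u 0)) Hu 1 ltac:(lra)) as [d [Hd H]].
  exists (Rabs (u 0) + 1), d. pose proof (Rabs_pos (u 0)). pose proof (Rle_abs (u 0)).
  split; [lra|]. split; [exact Hd|]. intros r Hr. specialize (H r Hr).
  apply Rabs_def2 in H. lra.
Qed.

(* A negative flux at the origin would force the singular behaviour [r^(-m)], or
   [ln (1/r)] for [m = 0], against the boundedness of [u]. *)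
Lemma radial_flux_not_below (d e : R) : 0 < d <= 1 -> 0 < e ->
  exists r, 0 < r < d /\ - e < G r.
Proof.
  intros Hd He. apply NNPP. intro Hn.
  assert (HG : forall r, 0 < r < d -> G r <= - e).
  { intros r Hr. apply Rnot_lt_le. intro H. apply Hn. now exists r. }
  destruct radial_u_bounded as [C [d0 [HC [Hd0 Hu]]]].
  set (s := Rmin d d0).
  pose proof (Rmin_l d d0 : s <= _). pose proof (Rmin_r d d0 : s <= _).
  assert (Hs : 0 < s) by (apply Rmin_glb_lt; lra).
  destruct (Nat.eq_dec m 0) as [Hm|Hm].
  - assert (Hvu : forall r, v r = u r) by (intro r; unfold v; rewrite Hm; simpl; field).
    destruct (ln_unbounded_left (s / 2) (C / e) ltac:(lra)) as [b [Hb Hln]].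
    assert (Hg : e * (ln (s / 2) - ln b) <= - v (s / 2) - - v b).
    { apply (log_growth (fun r => - v r) (fun r => - dv r)); try lra.
      - intros x Hx. apply (is_derive_opp v). apply radial_v_derive; lra.
      - intros x Hx. specialize (HG x ltac:(lra)). unfold G, k in HG. rewrite Hm in HG. simpl in HG.
        apply (Rmult_le_reg_r x); [lra|]. unfold Rdiv. rewrite Rmult_assoc, Rinv_l by lra. lra. }
    pose proof (radial_v_pos (s / 2) ltac:(lra)). rewrite (Hvu b) in Hg.
    specialize (Hu b ltac:(lra)).
    apply (Rmult_lt_compat_l e) in Hln; auto.
    replace (e * (C / e)) with C in Hln by (field; lra). lra.
  (* The mean value theorem on [[r, 2 * r]] and positivity of [v (2 * r)] give
     [e <= (2 * r) ^ k * (v r / r)], which equals [K * (r ^ m * u r)]. As [m >= 1] this is at most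
     [K * r * C], and the choice of [r] makes that at most [e / 2]. *)
  - set (K := 2 * 4 ^ m).
    assert (HK : 0 < K) by (unfold K; pose proof (pow_lt 4 m ltac:(lra)); lra).
    set (r := Rmin (s / 4) (e / (2 * C * K))).
    assert (Hr1 : r <= s / 4) by apply Rmin_l. assert (Hr2 : r <= e / (2 * C * K)) by apply Rmin_r.
    assert (HCK : 0 < 2 * C * K) by (apply Rmult_lt_0_compat; [lra | exact HK]).
    assert (Hr : 0 < r).
    { apply Rmin_glb_lt; [lra|]. apply Rmult_lt_0_compat; [lra | now apply Rinv_0_lt_compat]. }
    destruct (mean_value v dv r (2 * r)) as [c [Hc Hmv]]; [lra| |].
    { intros x Hx. apply radial_v_derive; lra. }
    specialize (HG c ltac:(lra)). unfold G in HG.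
    pose proof (radial_v_pos (2 * r) ltac:(lra)) as Hv2.
    assert (Hck : 0 < c ^ k <= (2 * r) ^ k) by (split; [apply pow_lt; lra | apply pow_incr; lra]).
    assert (Hneg : dv c < 0) by nra.
    assert (H2k : (2 * r) ^ k * dv c <= - e) by nra.
    assert (Hlow : e <= (2 * r) ^ k * (v r / r)).
    { assert (- dv c <= v r / r).
      { apply (Rmult_le_reg_r r); [lra|]. unfold Rdiv. rewrite Rmult_assoc, Rinv_l by lra. lra. }
      assert (0 < (2 * r) ^ k) by lra. nra. }
    assert (Hid : (2 * r) ^ k * (v r / r) = K * (r ^ m * u r)).
    { unfold K, k. rewrite radial_u by exact Hr. rewrite pow_add, pow_mult, pow_1.
      replace ((2 * r) ^ 2) with (4 * (r * r)) by ring. rewrite !Rpow_mult_distr. field. lra. }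
    rewrite Hid in Hlow.
    assert (Hrm : 0 < r ^ m <= r).
    { split; [apply pow_lt; lra|]. destruct m as [|n]; [congruence|].
      rewrite <- tech_pow_Rmult. assert (r ^ n <= 1); [|nra].
      rewrite <- (pow1 n). apply pow_incr; lra. }
    specialize (Hu r ltac:(lra)). assert (Hup : 0 < u r) by now apply Hsol.
    assert (r ^ m * u r <= r * C) by (apply Rmult_le_compat; lra).
    assert (K * (r ^ m * u r) <= K * (r * C)) by (apply Rmult_le_compat_l; lra).
    assert (r * (2 * C * K) <= e).
    { apply (Rmult_le_compat_r (2 * C * K)) in Hr2; [|lra].
      replace (e / (2 * C * K) * (2 * C * K)) with e in Hr2 by (field; lra). exact Hr2. }
    lra.
Qed.

(** Near 0 the flux is nonincreasing and nonpositive, so a single point where it exceeds [- e]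
    controls all smaller radii. *)
Lemma radial_flux_lim0 : lim0 G 0.
Proof.
  destruct radial_W_small as [d [Hd HW]]. apply lim0_spec. intros e He.
  destruct (radial_flux_not_below d e Hd He) as [s [Hs HG]].
  exists s. split; [lra|]. intros r Hr. rewrite Rminus_0_r.
  pose proof (radial_flux_mono d r s HW ltac:(lra) ltac:(lra)).
  pose proof (radial_flux_nonpos d r (proj2 Hd) HW ltac:(lra)).
  apply Rabs_def1; lra.
Qed.

(* Comparison with the supersolution [r^m (1 - r^2)]: the quotient [v / (1 - r^2)]
   is nondecreasing on (0, 1). *)
Lemma radial_v_bounded (r : R) : 0 < r <= / 2 -> v r <= 4 / 3 * v (/ 2).
Proof.
  intros Hr.
  (* [F] is [x ^ k * (1 - x ^ 2) ^ 2] times the derivative of [v / (1 - x ^ 2)]. It tends to 0 at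
     the origin because [x ^ (2 * m + 2) * v = x ^ (m + 2) * u] and [u] is bounded there. The factor
     [4 / 3] in the claim is the value of [1 / (1 - x ^ 2)] at [1 / 2]. *)
  set (F := fun x => G x * (1 - x ^ 2) + 2 * (x ^ (2 * m + 2) * v x)).
  assert (HF' : forall x, 0 < x < 1 -> is_derive F x
     (x ^ k * v x * ((W x - 1) * (1 - x ^ 2) + 2 * INR (2 * m + 2)))).
  { intros x Hx. evar_last.
    - apply (is_derive_Rplus (fun x => G x * (1 - x ^ 2)) (fun x => 2 * (x ^ (2 * m + 2) * v x))).
      + apply (is_derive_Rmult G (fun x => 1 - x ^ 2)); [apply radial_flux_derive; lra|].
        instantiate (1 := - (2 * x)). auto_derive; auto. ring.
      + apply is_derive_Rscal. apply (is_derive_Rmult (fun x => x ^ (2 * m + 2)) v).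
        * apply is_derive_pow_pos; lra.
        * apply radial_v_derive; lra.
    - unfold G. replace (2 * m + 2)%nat with (S k) by (unfold k; lia).
      rewrite <- (tech_pow_Rmult x k). field. lra. }
  assert (LF : lim0 F 0).
  { unfold F. replace 0 with (0 * (1 - 0) + 2 * (0 * u 0)) by ring.
    apply lim0_plus.
    - apply lim0_mult; [apply radial_flux_lim0|].
      apply lim0_minus; [apply lim0_const | apply (lim0_pow 1)].
    - apply (lim0_mult (fun _ => 2)); [apply lim0_const|].
      apply (lim0_ext (fun x => x ^ S (S m) * u x)).
      + intros x Hx. rewrite radial_u by exact Hx.
        replace (2 * m + 2)%nat with (S (S m) + m)%nat by lia. rewrite pow_add. ring.
      + apply lim0_mult; [apply lim0_pow | apply Hsol]. }
  assert (HF : forall x, 0 < x < 1 -> 0 <= F x).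
  { intros x Hx. apply (lim0_le_of_derive F _ 0 1 x LF Hx HF').
    intros y Hy. pose proof (radial_W_nonneg y ltac:(lra)). pose proof (radial_v_pos y ltac:(lra)).
    apply Rmult_le_pos; [apply Rmult_le_pos; [apply pow_le|]; lra|].
    assert (1 <= INR (2 * m + 2)) by (apply (le_INR 1); lia).
    assert (0 <= W y * (1 - y ^ 2)) by (apply Rmult_le_pos; nra). nra. }
  assert (Hq : v r / (1 - r ^ 2) <= v (/ 2) / (1 - (/ 2) ^ 2)).
  { apply (derive_nonneg_le (fun x => v x / (1 - x ^ 2))
      (fun x => (dv x * (1 - x ^ 2) - v x * - (2 * x)) / (1 - x ^ 2) ^ 2)); [lra| |].
    - intros x Hx. apply (is_derive_div v (fun x => 1 - x ^ 2)); [apply radial_v_derive; lra | | nra].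
      auto_derive; auto. ring.
    - intros x Hx. apply Rmult_le_pos.
      + specialize (HF x ltac:(lra)). unfold F, G in HF.
        assert (Hp : 0 < x ^ k) by (apply pow_lt; lra).
        replace (2 * m + 2)%nat with (S k) in HF by (unfold k; lia).
        rewrite <- (tech_pow_Rmult x k) in HF.
        apply (Rmult_le_reg_l (x ^ k)); auto. lra.
      + left. apply Rinv_0_lt_compat, pow_lt. nra. }
  replace (v (/ 2) / (1 - (/ 2) ^ 2)) with (4 / 3 * v (/ 2)) in Hq by field.
  pose proof (radial_v_pos (/ 2) ltac:(lra)).
  assert (Hpos : 0 < 1 - r ^ 2 <= 1) by (split; nra).
  apply (Rmult_le_compat_r (1 - r ^ 2)) in Hq; [|lra].
  replace (v r / (1 - r ^ 2) * (1 - r ^ 2)) with (v r) in Hq by (field; lra). nra.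
Qed.

Lemma radial_dv_nonpos (d r : R) : d <= 1 -> (forall r, 0 < r < d -> W r < 1) ->
  0 < r < d -> dv r <= 0.
Proof.
  intros Hd HW Hr. pose proof (radial_flux_nonpos d r Hd HW Hr) as HG. unfold G in HG.
  assert (0 < r ^ k) by (apply pow_lt; lra). nra.
Qed.

(** With [v <= C] and [W >= 0] the flux decreases at rate at most [C * r ^ k], so
    [G + C * r ^ (2 * m + 2)] increases from its limit 0. Dividing by [r ^ k] gives
    [- C * r <= dv r <= 0] near 0. *)
Lemma radial_dv_lim0 : lim0 dv 0.
Proof.
  destruct radial_W_small as [d [Hd HW]].
  set (C := 4 / 3 * v (/ 2)).
  assert (HC : 0 < C) by (unfold C; pose proof (radial_v_pos (/ 2) ltac:(lra)); lra).
  assert (Hlow : forall r, 0 < r < / 2 -> 0 <= G r + C * r ^ (2 * m + 2)).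
  { intros r Hr.
    apply (lim0_le_of_derive (fun r => G r + C * r ^ (2 * m + 2))
      (fun r => r ^ k * ((W r - 1) * v r) + C * (INR (2 * m + 2) / r * r ^ (2 * m + 2))) 0 (/ 2)); auto.
    - replace 0 with (0 + C * 0) by ring. apply lim0_plus; [apply radial_flux_lim0|].
      apply (lim0_mult (fun _ => C)); [apply lim0_const|].
      replace (2 * m + 2)%nat with (S (2 * m + 1)) by lia. apply lim0_pow.
    - intros x Hx. apply is_derive_Rplus; [apply radial_flux_derive; lra|].
      apply is_derive_Rscal, is_derive_pow_pos. lra.
    - intros x Hx. pose proof (radial_v_bounded x ltac:(lra)) as Hb. fold C in Hb.
      pose proof (radial_v_pos x ltac:(lra)). pose proof (radial_W_nonneg x ltac:(lra)).
      replace (INR (2 * m + 2) / x * x ^ (2 * m + 2)) with (x ^ k * INR (2 * m + 2)).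
      + assert (Hp : 0 < x ^ k) by (apply pow_lt; lra).
        assert (1 <= INR (2 * m + 2)) by (apply (le_INR 1); lia).
        replace (x ^ k * ((W x - 1) * v x) + C * (x ^ k * INR (2 * m + 2)))
          with (x ^ k * ((W x - 1) * v x + C * INR (2 * m + 2))) by ring.
        apply Rmult_le_pos; [lra|]. nra.
      + replace (2 * m + 2)%nat with (S k) by (unfold k; lia). rewrite <- (tech_pow_Rmult x k). field. lra. }
  apply lim0_spec. intros e He.
  set (s := Rmin (Rmin d (/ 2)) (e / C)).
  assert (H1 : s <= Rmin d (/ 2)) by apply Rmin_l. assert (H2 : s <= e / C) by apply Rmin_r.
  pose proof (Rmin_l d (/ 2)). pose proof (Rmin_r d (/ 2)).
  exists s. split.
  { apply Rmin_glb_lt; [apply Rmin_glb_lt; lra|].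
    apply Rmult_lt_0_compat; [lra | now apply Rinv_0_lt_compat]. }
  intros r Hr. rewrite Rminus_0_r.
  pose proof (radial_dv_nonpos d r (proj2 Hd) HW ltac:(lra)).
  specialize (Hlow r ltac:(lra)). unfold G in Hlow.
  replace (2 * m + 2)%nat with (S k) in Hlow by (unfold k; lia). rewrite <- (tech_pow_Rmult r k) in Hlow.
  assert (Hp : 0 < r ^ k) by (apply pow_lt; lra).
  assert (- (C * r) <= dv r).
  { apply (Rmult_le_reg_l (r ^ k)); auto. lra. }
  assert (C * r < e).
  { apply (Rmult_lt_reg_r (/ C)); [now apply Rinv_0_lt_compat|].
    replace (C * r * / C) with r by (field; lra). unfold Rdiv in H2. lra. }
  apply Rabs_def1; lra.
Qed.

Lemma radial_v_lim0 : exists a, lim0 v a.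
Proof.
  destruct radial_W_small as [d [Hd HW]].
  destruct (lim0_of_nonincreasing_bounded v (Rmin d (/ 2)) (4 / 3 * v (/ 2))) as [a [Ha _]].
  - apply Rmin_glb_lt; lra.
  - intros x y Hxy Hy. pose proof (Rmin_l d (/ 2)).
    apply (derive_nonpos_ge v dv); [lra| |].
    + intros z Hz. apply radial_v_derive; lra.
    + intros z Hz. apply (radial_dv_nonpos d); auto; lra.
  - intros x Hx. pose proof (Rmin_r d (/ 2)). apply radial_v_bounded; lra.
  - now exists a.
Qed.

Lemma radial_regular : exists v dv a,
  regular_profile m v dv W (Derive W) a /\ forall r, 0 < r -> u r = r ^ m * v r.
Proof.
  destruct radial_v_lim0 as [a Ha]. exists v, dv, a. split; [|exact radial_u].
  split; [exact radial_v_derive|]. split; [exact radial_dv_derive|].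
  split; [exact radial_W_derive|]. split; [exact radial_dW_derive|].
  split; [exact radial_v_pos|]. split; [exact Ha|]. split; [exact radial_dv_lim0|].
  split; [exact radial_W_lim0 | exact radial_dW_lim0].
Qed.

End Regularity.

(** * Uniqueness of radial solutions and conclusion *)

Lemma radial_unique (m : nat) (u1 W1 u2 W2 : R -> R) :
  is_radial_solution m u1 W1 -> is_radial_solution m u2 W2 ->
  forall r, 0 <= r -> u1 r = u2 r /\ W1 r = W2 r.
Proof.
  intros H1 H2.
  destruct (radial_regular m u1 W1 H1) as [v1 [dv1 [a1 [P1 Hu1]]]].
  destruct (radial_regular m u2 W2 H2) as [v2 [dv2 [a2 [P2 Hu2]]]].
  assert (Hlim : forall u v, (forall r, 0 < r -> u r = r ^ m * v r) -> is_lim u p_infty 0 ->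
    is_lim (fun r => r ^ m * v r) p_infty 0).
  { intros u v Hu. apply is_lim_ext_loc. exists 0. intros r Hr. now apply Hu. }
  assert (Ha : a1 = a2).
  { apply Rle_antisym; apply Rnot_lt_le.
    - apply (initial_values_not_lt m _ _ _ _ _ _ _ _ _ _ P2 P1), (Hlim u1); [exact Hu1 | apply H1].
    - apply (initial_values_not_lt m _ _ _ _ _ _ _ _ _ _ P1 P2), (Hlim u2); [exact Hu2 | apply H2]. }
  subst a2.
  assert (Hpos : forall r, 0 < r -> u1 r = u2 r /\ W1 r = W2 r).
  { intros r Hr. destruct (regular_profile_unique m _ _ _ _ _ _ _ _ _ P1 P2 r Hr) as [Hv HW].
    rewrite Hu1, Hu2, Hv by exact Hr. now split. }
  intros r [Hr | <-]; [now apply Hpos|].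
  destruct H1 as [_ [_ [_ [L1 [Z1 _]]]]], H2 as [_ [_ [_ [L2 [Z2 _]]]]].
  split; [|congruence].
  apply (lim0_unique u1); [exact L1|].
  apply (lim0_ext u2); [|exact L2]. intros r Hr. symmetry. now apply Hpos.
Qed.

Theorem theorem5p2 (m : nat) :
  (exists u W : R -> R, is_radial_solution m u W) /\
  (forall u1 W1 u2 W2 : R -> R,
     is_radial_solution m u1 W1 -> is_radial_solution m u2 W2 ->
     forall r, 0 <= r -> u1 r = u2 r /\ W1 r = W2 r).
Proof.
  split.
  - apply radial_exists.
  - intros u1 W1 u2 W2. apply radial_unique.
Qed.
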